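(* Let (H1), (H2), (H3) hold, let $\gamma$ be radial, $\gamma(x,x')=\hat\gamma(|x-x'|)$, with $\hat\gamma$ Lipschitz continuous on $[\delta_{\min},\delta_{\max}]$. Let $F\in L^2(\Omega)$ be independent of $\delta$, and for $\delta\in[\delta_{\min},\delta_{\max}]$ let $u(\delta)\in V$ be the solution of $a(u(\delta),v;\delta)=(F,v)_{L^2(\Omega)}$ for all $v\in V$. Assume that $u(\delta)\in H^1_0(\Omega)$ for all $\delta\in[\delta_{\min},\delta_{\max}]$ with $\sup_{\delta}\|u(\delta)\|_{H^1_0(\Omega)}<\infty$. Then $u$ is differentiable with respect to $\delta$, i.e. $u'_\delta(\delta)=\frac{d}{d\delta}u(\delta)$ exists in $V$ for every $\delta\in[\delta_{\min},\delta_{\max}]$ (one-sided at endpoints), and $u'_\delta$ is Lipschitz continuous with respect to $\delta$; that is, $u\in C^{1,1}([\delta_{\min},\delta_{\max}],V)$.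
   Context: $\Omega\subset\mathbb{R}^n$ is a bounded domain with Lipschitz boundary and $0<\delta_{\min}<\delta_{\max}<\infty$. $\gamma:\mathbb{R}^n\times\mathbb{R}^n\to[0,\infty)$ is a (measurable) symmetric kernel; for $\delta\in[\delta_{\min},\delta_{\max}]$ the truncated kernel is $\gamma(x,x';\delta)=\gamma(x,x')$ if $|x-x'|\le\delta$ and $0$ otherwise. (H1): $\gamma(x,x';\delta)\ge0$, it vanishes for $|x-x'|>\delta$, and there is $\gamma_0>0$ with $\gamma(x,x';\delta)\ge\gamma_0$ whenever $|x-x'|\le\delta_{\min}/2$. (H2): there is $\hat\gamma:\mathbb{R}^+\to\mathbb{R}^+$ with $\gamma(x,x';\delta)\le\hat\gamma(|x-x'|)$ and $\xi^{n-1}\hat\gamma(\xi)\in L^1((\delta_{\min},\delta_{\max}))$. (H3): there is $C_\gamma>0$ with $\xi^{n-1}\hat\gamma(\xi)\le C_\gamma$ for $\xi\in(\delta_{\min},\delta_{\max})$. Functions on $\Omega$ are extended by zero to $\mathbb{R}^n$. Let $S_\delta=\{(x,x')\in\mathbb{R}^{2n}:|x-x'|\le\delta\}$, $$a(u,v;\delta)=\int_{S_\delta}(u(x)-u(x'))(v(x)-v(x'))\gamma(x,x')\,d(x',x),\qquad \|u\|_{V_\delta}^2=a(u,u;\delta),$$ and $V_\delta=\{v\in L^2(\mathbb{R}^n): v=0 \text{ a.e. outside }\Omega,\ \|v\|_{V_\delta}<\infty\}$. For a fixed reference value $\delta^\star\in[\delta_{\min},\delta_{\max}]$ put $V=V_{\delta^\star}$,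 $\|\cdot\|_V=\|\cdot\|_{V_{\delta^\star}}$ (all $V_\delta$, $\delta\in[\delta_{\min},\delta_{\max}]$, coincide as sets with equivalent norms). Standing assumption (Poincaré): $\|v\|_{L^2(\Omega)}\le C_P\|v\|_{V_\delta}$ for all $v\in V_\delta$, with $C_P>0$ independent of $\delta\in[\delta_{\min},\delta_{\max}]$. *)

(* Defs.v *)
From HB Require Import structures.
From mathcomp Require Import all_boot all_order all_algebra.
From mathcomp Require Import all_classical all_reals all_analysis.

Set Implicit Arguments.
Unset Strict Implicit.
Unset Printing Implicit Defensive.

Import Order.TTheory GRing.Theory Num.Theory.
Import numFieldTopology.Exports numFieldNormedType.Exports.

Local Open Scope classical_set_scope.
Local Open Scope ring_scope.

Definition rV_display : measure_display. Proof. exact. Qed.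

(* The library has no measurable structure on row vectors: 'rV[R]_n gets the
   sigma-algebra generated by the coordinates (the Borel sets of R^n). *)
Section measurable_rV.
Context {R : realType} (n : nat).

Definition rV_coord (i : 'I_n) (x : 'rV[R]_n) : R := x ord0 i.

Let rV_set0 : g_sigma_preimage rV_coord set0.
Proof. exact: sigma_algebra0. Qed.

Let rV_setC A : g_sigma_preimage rV_coord A ->
  g_sigma_preimage rV_coord (~` A).
Proof. exact: sigma_algebraC. Qed.

Let rV_bigcup (F : (set 'rV[R]_n)^nat) :
  (forall i, g_sigma_preimage rV_coord (F i)) ->
  g_sigma_preimage rV_coord (\bigcup_i (F i)).
Proof. exact: sigma_algebra_bigcup. Qed.

HB.instance Definition _ := @isMeasurable.Build rV_display
  'rV[R]_n (g_sigma_preimage rV_coord) rV_set0 rV_setC rV_bigcup.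

End measurable_rV.

Lemma measurable_fun_rVP d (T : measurableType d) (R : realType) n
    (f : T -> 'rV[R]_n) :
  (forall i, measurable_fun [set: T] (fun x => f x ord0 i)) ->
  measurable_fun [set: T] f.
Proof.
move=> mf.
have: g_sigma_preimage (fun i => @rV_coord R n i \o f) `<=` measurable.
  apply: smallest_sub; first exact: sigma_algebra_measurable.
  case: n f mf => [|n] f mf; first by rewrite big_ord0.
  rewrite -bigcup_mkord_ord; apply: bigcup_sub => i Ii.
  by move=> A [B mB <-]; exact: mf.
by rewrite g_sigma_preimage_comp => mf' _ A mA; apply: mf'; exists A.
Qed.

Lemma measurable_rV_coord (R : realType) n (i : 'I_n) :
  measurable_fun [set: 'rV[R]_n] (@rV_coord R n i).
Proof.
move=> _ Y mY; rewrite setTI; apply: sub_sigma_algebra => /=.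
rewrite -bigcup_seq/=; exists i => /=; first by rewrite mem_index_enum.
by exists Y => //; rewrite setTI.
Qed.

(* R x R^n -> R^(n+1) *)
Definition rV_cons {R : realType} n (p : measurableTypeR R * 'rV[R]_n) :
    'rV[R]_n.+1 :=
  \row_i oapp (fun j => p.2 ord0 j) p.1 (unlift ord0 i).

Lemma measurable_rV_cons {R : realType} n :
  measurable_fun [set: measurableTypeR R * 'rV[R]_n] (@rV_cons R n).
Proof.
apply: measurable_fun_rVP => i.
under eq_fun do rewrite mxE.
case: unliftP => [j _|_] /=; last exact: measurable_fst.
exact: (measurableT_comp (measurable_rV_coord j) measurable_snd).
Qed.

HB.instance Definition _ (R : realType) n :=
  isMeasurableFun.Build _ _ _ _ (@rV_cons R n) (@measurable_rV_cons R n).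


(* The product of the Lebesgue measure on R with a measure on R^n, carried
   over to R^(n+1). *)
Section leb_succ.
Context {R : realType} (n : nat).
Variable m : {sigma_finite_measure set 'rV[R]_n -> \bar R}.

Definition leb_succ : set 'rV[R]_n.+1 -> \bar R :=
  pushforward (@lebesgue_measure R \x m)%E (@rV_cons R n).

Let leb_succ0 : leb_succ set0 = 0%E.
Proof. by rewrite /leb_succ /pushforward preimage_set0 measure0. Qed.

Let leb_succ_ge0 A : (0 <= leb_succ A)%E.
Proof. exact: measure_ge0. Qed.

Let leb_succ_sigma_additive : semi_sigma_additive leb_succ.
Proof. exact: measure_semi_sigma_additive. Qed.

HB.instance Definition _ := isMeasure.Build _ _ _ leb_succ
  leb_succ0 leb_succ_ge0 leb_succ_sigma_additive.

Let leb_succ_sigma_finite : sigma_finite [set: 'rV[R]_n.+1] leb_succ.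
Proof.
have /sigma_finiteP[A [TA ndA Aoo]] := sigma_finiteT (@lebesgue_measure R).
have /sigma_finiteP[B [TB ndB Boo]] := sigma_finiteT m.
pose F i := A i `*` B i.
have TF : [set: measurableTypeR R * 'rV[R]_n] = \bigcup_i F i.
  rewrite -setXTT TA TB predeqE => -[x y]; split; last first.
    by move=> [i _ []/= ? ?]; split; exists i.
  move=> [/= [i _ Aix] [k _ Bky]]; exists (maxn i k) => //; split.
  - by move: x Aix; exact/subsetPset/ndA/leq_maxl.
  - by move: y Bky; exact/subsetPset/ndB/leq_maxr.
have mF i : measurable (F i) /\ ((@lebesgue_measure R \x m) (F i) < +oo)%E.
  have [? ?] := Aoo i; have [? ?] := Boo i; split; first exact: measurableX.
  by rewrite product_measure1E// lte_mul_pinfty// ge0_fin_numE.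
pose uncons (x : 'rV[R]_n.+1) : measurableTypeR R * 'rV[R]_n :=
  (x ord0 ord0, \row_j x ord0 (lift ord0 j)).
have unconsK : cancel (@rV_cons R n) uncons.
  move=> [a y]; rewrite /uncons /rV_cons !mxE unlift_none /=; congr pair.
  by apply/rowP => j; rewrite !mxE liftK.
have muncons : measurable_fun [set: _] uncons.
  apply/measurable_fun_pairP; split; first exact: measurable_rV_coord.
  apply: measurable_fun_rVP => i /=.
  by under eq_fun do rewrite mxE; exact: measurable_rV_coord.
exists (fun i => uncons @^-1` F i).
  by rewrite -preimage_bigcup -TF preimage_setT.
move=> i; have [mFi Fioo] := mF i; split.
  by rewrite -[X in measurable X]setTI; exact: muncons.
rewrite /leb_succ /pushforward -comp_preimage.
by rewrite (_ : uncons \o _ = id) //; apply/funext => p /=; rewrite unconsK.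
Qed.

HB.instance Definition _ := Measure_isSigmaFinite.Build _ _ _ leb_succ
  leb_succ_sigma_finite.

End leb_succ.

(* Lebesgue measure on R^n; see leb_box. *)
Fixpoint leb {R : realType} (n : nat) :
    {sigma_finite_measure set 'rV[R]_n -> \bar R} :=
  match n with
  | 0%N => \d_ (0 : 'rV[R]_0)
  | n'.+1 => leb_succ (leb n')
  end.

Lemma leb_box (R : realType) n (A : 'I_n -> set R) :
  (forall i, measurable (A i)) ->
  @leb R n [set x | forall i, A i (x ord0 i)] =
    (\prod_(i < n) @lebesgue_measure R (A i))%E.
Proof.
elim: n A => [|n IHn] A mA.
  rewrite big_ord0 /= diracE mem_set // => -[]//.
have E : @rV_cons R n @^-1` [set x | forall i, A i (x ord0 i)] =
    A ord0 `*` [set x : 'rV[R]_n | forall i, A (lift ord0 i) (x ord0 i)].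
  apply/seteqP; split => -[a y] /=.
    move=> h; split => [|i].
      by have := h ord0; rewrite /rV_cons mxE unlift_none.
    by have := h (lift ord0 i); rewrite /rV_cons mxE liftK.
  move=> [h0 h] i; rewrite /rV_cons mxE.
  by case: unliftP => [j ->|->] //=; exact: h.
have mB : measurable
    [set x : 'rV[R]_n | forall i, A (lift ord0 i) (x ord0 i)].
  rewrite (_ : [set x | _] =
      \bigcap_(i in [set: 'I_n]) (@rV_coord R n i @^-1` A (lift ord0 i))).
    apply: fin_bigcap_measurable => // i _.
    by rewrite -[X in measurable X]setTI; exact: measurable_rV_coord.
  by apply/seteqP; split => x /= h i; [move=> _|]; exact: h.
transitivity ((@lebesgue_measure R \x leb n)%E
    (@rV_cons R n @^-1` [set x | forall i, A i (x ord0 i)])) => //.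
rewrite E product_measure1E //; last exact: mA.
rewrite big_ord_recl; congr (_ * _)%E.
exact: (IHn (fun i => A (lift ord0 i))).
Qed.

Section euclidean.
Context {R : realType} {n : nat}.
Implicit Types x y : 'rV[R]_n.

Definition dotv x y : R := \sum_(i < n) x ord0 i * y ord0 i.

(* The library norm on 'rV[R]_n is the maximum norm. *)
Definition enorm x : R := Num.sqrt (dotv x x).

Definition basis_vec (i : 'I_n) : 'rV[R]_n := delta_mx ord0 i.

End euclidean.

(* Near each boundary point z there is a unit vector e (the vertical axis of
   the local coordinates, the horizontal ones being those of its orthogonal
   hyperplane) such that Omega is locally the strict epigraph of a Lipschitz
   function phi on that hyperplane. *)
Definition lipschitz_boundary {R : realType} {n : nat} (Omega : set 'rV[R]_n) :=
  forall z, (closure Omega `\` interior Omega) z ->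
  exists (e : 'rV[R]_n) (phi : 'rV[R]_n -> R),
    [/\ enorm e = 1,
        [lipschitz phi y | y in [set y | dotv y e = 0]] &
        \forall y \near z,
          Omega y <-> phi (y - dotv y e *: e) < dotv y e].

Definition lipschitz_domain {R : realType} {n : nat} (Omega : set 'rV[R]_n) :=
  [/\ Omega !=set0, open Omega, connected Omega, bounded_set Omega &
      lipschitz_boundary Omega].

Section sobolev.
Context {R : realType} {n : nat}.
Variable Omega : set 'rV[R]_n.
Implicit Types v w phi : 'rV[R]_n -> R.

Definition L2 v := v \_ Omega \in Lfun (leb n) (2%:E)%E.

Definition L2norm v : \bar R := 'N[leb n]_(2%:E)%E[EFin \o (v \_ Omega)].

Definition partial (i : 'I_n) phi : 'rV[R]_n -> R := 'D_(basis_vec i) phi.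

Fixpoint Ck (k : nat) phi : Prop :=
  match k with
  | 0%N => continuous phi
  | k'.+1 => continuous phi /\
      forall i, (forall x, derivable phi x (basis_vec i)) /\
                Ck k' (partial i phi)
  end.

Definition test_fun phi :=
  (forall k, Ck k phi) /\
  exists K, [/\ compact K, K `<=` Omega & forall x, ~ K x -> phi x = 0].

Definition is_weak_grad v (g : 'I_n -> 'rV[R]_n -> R) :=
  forall i, L2 (g i) /\
    forall phi, test_fun phi ->
      (\int[leb n]_(x in Omega) (v x * partial i phi x)%:E =
       - \int[leb n]_(x in Omega) (g i x * phi x)%:E)%E.

Definition H1 v := L2 v /\ exists g, is_weak_grad v g.

(* Weak gradients are unique almost everywhere on Omega, so the choice of a
   representative is irrelevant below. *)
Definition weak_grad v : 'I_n -> 'rV[R]_n -> R :=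
  xget (fun _ _ => 0) [set g | is_weak_grad v g].

Definition H1norm v : \bar R :=
  ((L2norm v `^ 2 + \sum_(i < n) L2norm (weak_grad v i) `^ 2) `^ 2^-1)%E.

Definition H10 v :=
  H1 v /\ forall eps : R, 0 < eps -> exists2 phi, test_fun phi &
    (H1norm (v \- phi)%R < eps%:E)%E.

End sobolev.

Section nonlocal.
Context {R : realType} {n : nat}.
Variables (Omega : set 'rV[R]_n) (gam : 'rV[R]_n -> 'rV[R]_n -> R).
Implicit Types (u v : 'rV[R]_n -> R) (delta : R).

Definition trunc_kernel (x x' : 'rV[R]_n) delta : R :=
  if enorm (x - x') <= delta then gam x x' else 0.

Definition strip delta : set ('rV[R]_n * 'rV[R]_n) :=
  [set z | enorm (z.1 - z.2) <= delta].

Definition aform u v delta : \bar R :=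
  (\int[leb n \x leb n]_(z in strip delta)
     ((u z.1 - u z.2) * (v z.1 - v z.2) * gam z.1 z.2)%:E)%E.

Definition Vnorm delta v : \bar R := (aform v v delta `^ 2^-1)%E.

Definition Vspace delta v :=
  [/\ v \in Lfun (leb n) (2%:E)%E,
      {ae leb n, forall x, ~ Omega x -> v x = 0} &
      (Vnorm delta v < +oo)%E].

(* Functions are representatives of their classes in V_delta. *)
Definition V_derivative_within (D : set R) deltas
    (u : R -> 'rV[R]_n -> R) delta (du : 'rV[R]_n -> R) :=
  Vspace deltas du /\
  Vnorm deltas (fun x => h^-1 * (u (delta + h) x - u delta x) - du x)
    @[h --> within [set h | D (delta + h)] 0^'] --> 0%E.

Definition V_C11 (D : set R) deltas (u : R -> 'rV[R]_n -> R) :=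
  (forall delta, D delta -> Vspace deltas (u delta)) /\
  exists du : R -> 'rV[R]_n -> R,
    (forall delta, D delta ->
       V_derivative_within D deltas u delta (du delta)) /\
    exists L : R, forall d1 d2, D d1 -> D d2 ->
      (Vnorm deltas (du d1 \- du d2)%R <= (L * `|d1 - d2|)%:E)%E.

Variables (dmin dmax : R) (gamh : R -> R).

Definition hypH1 :=
  (forall delta x x', dmin <= delta <= dmax ->
     0 <= trunc_kernel x x' delta /\
     (delta < enorm (x - x') -> trunc_kernel x x' delta = 0)) /\
  exists2 gam0 : R, 0 < gam0 &
    forall delta x x', dmin <= delta <= dmax ->
      enorm (x - x') <= dmin / 2 -> gam0 <= trunc_kernel x x' delta.

Definition hypH2 :=
  [/\ forall xi, 0 <= xi -> 0 <= gamh xi,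
      forall delta x x', dmin <= delta <= dmax ->
        trunc_kernel x x' delta <= gamh (enorm (x - x')) &
      (@lebesgue_measure R).-integrable `]dmin, dmax[
        (fun xi => (xi ^+ n.-1 * gamh xi)%:E)].

Definition hypH3 :=
  exists2 Cg : R, 0 < Cg &
    forall xi, dmin < xi < dmax -> xi ^+ n.-1 * gamh xi <= Cg.

Definition poincare :=
  exists2 CP : R, 0 < CP &
    forall delta v, dmin <= delta <= dmax -> Vspace delta v ->
      (L2norm Omega v <= CP%:E * Vnorm delta v)%E.

End nonlocal.

Arguments hypH3 {R} n dmin dmax gamh.

(* Main.v *)
Require Import Defs.
From HB Require Import structures.
From mathcomp Require Import all_boot all_order all_algebra.
From mathcomp Require Import all_classical all_reals all_analysis.
From mathcomp Require Import ring lra measurable_realfun.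

(* Fubini in the variables (x, y) = (x, x' - x) turns a(u, v; t) - a(u, v; s)
   into the integral over the shell s < |y| <= t of gamh(|y|) c(y), where
   c(y) = (u - u(. + y), v - v(. + y)).  Since |c| <= 4 |u| |v| in terms of L^2
   norms, a is Lipschitz in delta.  If u is in H^1_0 then c is Lipschitz with a
   constant proportional to |v|, so replacing gamh(|y|) c(y) by its value at the
   radial projection of y to the sphere of radius s shows that the difference
   quotients of a(u, v; .) are Lipschitz in their end points, uniformly in |v|.
   The difference quotients w(s, t) = (u(t) - u(s)) / (t - s) solve
   a(w(s, t), v; s) = - (a(u(t), v; t) - a(u(t), v; s)) / (t - s), and testing the
   equation of w(s, t) - w(s', t') with itself gives, by the Poincare inequality,
   |w(s, t) - w(s', t')|_V <= C (|t - s| + |t' - s'| + |s - s'|).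
   Completeness of V then yields the derivative and its Lipschitz continuity. *)

Set Implicit Arguments.
Unset Strict Implicit.
Unset Printing Implicit Defensive.

Import Order.TTheory GRing.Theory Num.Theory.
Import numFieldTopology.Exports numFieldNormedType.Exports.

Local Open Scope classical_set_scope.
Local Open Scope ring_scope.

(** * Square-integrable functions *)

Section L2.
Context d (T : measurableType d) (R : realType).
Variable mu : {measure set T -> \bar R}.
Implicit Types f g h : T -> R.

(** The kernel may be singular near the diagonal, but changing delta only affects pairs at distance
    between dmin and dmax, where gamh is bounded. The test functions lie in V only: Poincare
    controls their L^2 norm, nothing controls their gradient. All smoothness of c must therefore
    come from u, and it can, because translation invariance gives c(y) = 2 (u, v) - (u(. - y), v) -
    (u(. + y), v). The quotients w(s, t) and w(s', t') solve equations with different forms and with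
    data built from different functions u(t) and u(t'). Changing the form and replacing u(t) by
    u(t') cost L^2 norms only, by the Lipschitz continuity of a in delta. The H^1_0 bound enters
    once, for two slopes of the same function u(t'), so no gradient of u(t) - u(t') or of a quotient
    has to be estimated. The estimate with four free end points serves twice: s = s' gives the
    Cauchy property, and t -> s, t' -> s' gives the Lipschitz continuity of the derivative. Both
    orders of s and t are allowed, so end points of the interval are treated like interior ones. *)

Definition sqint f := measurable_fun [set: T] f /\
  mu.-integrable [set: T] (fun x => (f x ^+ 2)%:E).

Definition ip f g : R := (\int[mu]_x (f x * g x))%R.

Definition nrm f : R := Num.sqrt (ip f f).

Lemma sqint_mul f g : sqint f -> sqint g ->
  mu.-integrable [set: T] (fun x => (f x * g x)%:E).
Proof.
move=> [mf f2] [mg g2].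
apply: (le_integrable measurableT) (integrableD measurableT f2 g2).
  by apply/measurable_EFinP; exact: measurable_funM.
move=> x _; rewrite /= lee_fin normrM.
rewrite [leRHS]ger0_norm ?addr_ge0 ?sqr_ge0//.
rewrite -[f x ^+ 2]real_normK ?num_real// -[g x ^+ 2]real_normK ?num_real//.
by move: (`|f x|) (`|g x|) (normr_ge0 (f x)) (normr_ge0 (g x)) => a b a0 b0; nra.
Qed.

Lemma sqint_lin a b f g : sqint f -> sqint g ->
  sqint (fun x => a * f x + b * g x).
Proof.
move=> sf sg; have [[mf f2] [mg g2]] := (sf, sg).
split; first by apply: measurable_funD; exact: measurable_funM.
have /= i1 := integrableZl measurableT (a ^+ 2) f2.
have /= i2 := integrableZl measurableT (b ^+ 2) g2.
have /= i3 := integrableZl measurableT (2 * a * b) (sqint_mul sf sg).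
have /= := integrableD measurableT (integrableD measurableT i1 i2) i3.
apply: eq_integrable => // x _.
by rewrite /= -!EFinM -!EFinD; congr EFin; ring.
Qed.

Lemma sqintB f g : sqint f -> sqint g -> sqint (f \- g).
Proof.
move=> sf sg; have := sqint_lin 1 (-1) sf sg.
by congr sqint; apply/funext => x; rewrite /= mul1r mulN1r.
Qed.

Lemma sqintZ a f : sqint f -> sqint (fun x => a * f x).
Proof.
move=> sf; have := sqint_lin a 0 sf sf.
by congr sqint; apply/funext => x; rewrite /= mul0r addr0.
Qed.

Lemma ipC f g : ip f g = ip g f.
Proof. by congr Rintegral; apply/funext => x; rewrite mulrC. Qed.

Lemma ip_linl a b f g h : sqint f -> sqint g -> sqint h ->
  ip (fun x => a * f x + b * g x) h = a * ip f h + b * ip g h.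
Proof.
move=> sf sg sh; rewrite /ip.
have i1 := sqint_mul sf sh; have i2 := sqint_mul sg sh.
rewrite -!RintegralZl// -RintegralD//.
- by congr Rintegral; apply/funext => x; ring.
- exact: (integrableZl measurableT a i1).
- exact: (integrableZl measurableT b i2).
Qed.

Lemma ip_linr a b f g h : sqint f -> sqint g -> sqint h ->
  ip h (fun x => a * f x + b * g x) = a * ip h f + b * ip h g.
Proof. by move=> sf sg sh; rewrite ipC ip_linl// ![ip _ h]ipC. Qed.

Lemma ipBl f g h : sqint f -> sqint g -> sqint h ->
  ip (f \- g) h = ip f h - ip g h.
Proof.
move=> sf sg sh; have := ip_linl 1 (-1) sf sg sh.
rewrite mul1r mulN1r => <-; congr (ip _ h).
by apply/funext => x; rewrite /= mul1r mulN1r.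
Qed.

Lemma ipZl a f h : sqint f -> sqint h ->
  ip (fun x => a * f x) h = a * ip f h.
Proof.
move=> sf sh; have := ip_linl a 0 sf sf sh.
rewrite mul0r addr0 => <-; congr (ip _ h).
by apply/funext => x; rewrite /= mul0r addr0.
Qed.

Lemma ipBr f g h : sqint f -> sqint g -> sqint h ->
  ip h (f \- g) = ip h f - ip h g.
Proof. by move=> sf sg sh; rewrite ipC ipBl// ![ip _ h]ipC. Qed.

Lemma ip_ge0 f : 0 <= ip f f.
Proof. by apply: Rintegral_ge0 => x _; rewrite -expr2 sqr_ge0. Qed.

Lemma nrm_ge0 f : 0 <= nrm f. Proof. exact: sqrtr_ge0. Qed.

Lemma nrm_sqr f : nrm f ^+ 2 = ip f f.
Proof. by rewrite /nrm sqr_sqrtr ?ip_ge0. Qed.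

Lemma ip_EFin f g : sqint f -> sqint g ->
  (ip f g)%:E = (\int[mu]_x (f x * g x)%:E)%E.
Proof.
move=> sf sg; rewrite /ip /Rintegral fineK//.
exact: (integrable_fin_num measurableT (sqint_mul sf sg)).
Qed.

Lemma nrm_sqr_EFin f : sqint f -> ((nrm f ^+ 2)%:E = \int[mu]_x (f x ^+ 2)%:E)%E.
Proof. by move=> sf; rewrite nrm_sqr ip_EFin. Qed.

Lemma sqint_lty f : measurable_fun [set: T] f ->
  (\int[mu]_x (f x ^+ 2)%:E < +oo)%E -> sqint f.
Proof.
move=> mf flt; split => //; apply/integrableP; split.
  by apply/measurable_EFinP; exact: measurable_funX.
by under eq_integral do rewrite gee0_abs ?lee_fin ?sqr_ge0//.
Qed.

(* Nonnegativity of the quadratic polynomial |f - t g|^2 in t. *)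
Lemma cauchy_schwarz f g : sqint f -> sqint g -> `|ip f g| <= nrm f * nrm g.
Proof.
move=> sf sg.
have H a b : 0 <= a ^+ 2 * nrm f ^+ 2 + 2 * a * b * ip f g + b ^+ 2 * nrm g ^+ 2.
  have := ip_ge0 (fun x => a * f x + b * g x).
  rewrite ip_linl ?ip_linr//; do ?exact: sqint_lin.
  by rewrite (ipC g f) !nrm_sqr; congr (_ <= _); ring.
have F0 := nrm_ge0 f; have G0 := nrm_ge0 g.
move: (nrm f) (nrm g) (ip f g) F0 G0 H => F G I F0 G0 H.
rewrite -[leRHS]ger0_norm ?mulr_ge0// -ler_sqr ?nnegrE// !real_normK ?num_real//.
have [/eqP G00|G00] := eqVneq (G ^+ 2) 0.
  rewrite sqrf_eq0 in G00; move/eqP: G00 => G00; subst G; rewrite mulr0 expr0n/=.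
  have [->|I0] := eqVneq I 0; first by rewrite expr0n.
  have := H 1 (- (F ^+ 2 + 1) / (2 * I)).
  rewrite (_ : _ + _ = -1); first by lra.
  by rewrite expr0n/=; field.
have G2 : 0 < G ^+ 2 by rewrite lt_def G00 sqr_ge0.
have := H (G ^+ 2) (- I).
have -> : (G ^+ 2) ^+ 2 * F ^+ 2 + 2 * G ^+ 2 * - I * I + (- I) ^+ 2 * G ^+ 2
  = G ^+ 2 * (F ^+ 2 * G ^+ 2 - I ^+ 2) by ring.
by rewrite pmulr_rge0// subr_ge0 -exprMn.
Qed.

Lemma nrmZ a f : sqint f -> nrm (fun x => a * f x) = `|a| * nrm f.
Proof.
move=> sf; have sa := sqintZ a sf.
rewrite /nrm (ipZl a sf sa) ipC (ipZl a sf sf).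
by rewrite mulrA -expr2 sqrtrM ?sqr_ge0// sqrtr_sqr.
Qed.

Lemma nrmD f g : sqint f -> sqint g -> nrm (f \+ g) <= nrm f + nrm g.
Proof.
move=> sf sg; rewrite -ler_sqr ?nnegrE ?addr_ge0 ?nrm_ge0//.
rewrite nrm_sqr (_ : f \+ g = fun x => 1 * f x + 1 * g x); last first.
  by apply/funext => x; rewrite /= !mul1r.
rewrite ip_linl ?ip_linr//; do ?exact: sqint_lin.
rewrite (ipC g f) -!nrm_sqr.
have := cauchy_schwarz sf sg; rewrite ler_norml => /andP[_].
nra.
Qed.

Lemma nrmB f g : sqint f -> sqint g -> nrm (f \- g) <= nrm f + nrm g.
Proof.
move=> sf sg; have := nrmD sf (sqintZ (-1) sg).
rewrite nrmZ// normrN1 mul1r; apply: le_trans.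
by rewrite le_eqVlt; apply/orP; left; apply/eqP; congr nrm;
  apply/funext => x; rewrite /= mulN1r.
Qed.

Lemma nrmBC f g : nrm (f \- g) = nrm (g \- f).
Proof.
rewrite /nrm /ip; congr (Num.sqrt (Rintegral _ _ _)).
by apply/funext => x /=; ring.
Qed.

Lemma nrmB3 f g h : sqint f -> sqint g -> sqint h ->
  nrm (f \- h) <= nrm (f \- g) + nrm (g \- h).
Proof.
move=> sf sg sh; rewrite (_ : f \- h = (f \- g) \+ (g \- h)).
  by apply: nrmD; exact: sqintB.
by apply/funext => x /=; ring.
Qed.

(** Used to pass between a function that vanishes a.e. outside [Omega] and its restriction, which
    are equal only a.e. *)
Lemma ae_sqint f g : {ae mu, forall x, f x = g x} ->
  measurable_fun [set: T] f -> sqint g -> sqint f /\ nrm f = nrm g.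
Proof.
move=> fg mf sg; have [mg g2] := sg.
have E : (\int[mu]_x (f x ^+ 2)%:E = \int[mu]_x (g x ^+ 2)%:E)%E.
  apply: ge0_ae_eq_integral => //.
  - by apply/measurable_EFinP; exact: measurable_funX.
  - by apply/measurable_EFinP; exact: measurable_funX.
  - by move=> x _; rewrite lee_fin sqr_ge0.
  - by move=> x _; rewrite lee_fin sqr_ge0.
  - by apply: filterS fg => x -> .
have sf : sqint f.
  apply: sqint_lty => //; rewrite E -nrm_sqr_EFin//; exact: ltry.
split => //; apply/eqP; rewrite -(@eqrXn2 _ 2) ?nrm_ge0//.
by rewrite -eqe !nrm_sqr_EFin// E.
Qed.

Lemma Lfun_sqint f : f \in Lfun mu (2%:E)%E <-> sqint f.
Proof.
split => [fL|[mf f2]].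
  split; first by move/sub_Lfun_mfun : (fL); rewrite inE.
  exact: Lfun2_integrable_sqr.
rewrite inE/=; apply/andP; split; rewrite inE//=.
rewrite /finite_norm unlock /=; apply: poweR_lty.
move/integrableP : f2 => [_]; apply: le_lt_trans.
rewrite le_eqVlt; apply/orP; left; apply/eqP; apply: eq_integral => x _ /=.
by rewrite normrX -powR_mulrn ?normr_ge0.
Qed.

Lemma Lnorm_nrm f : sqint f -> ('N[mu]_(2%:E)[EFin \o f])%E = (nrm f)%:E.
Proof.
move=> sf; rewrite unlock /=.
rewrite (_ : (\int[mu]_x _)%E = (nrm f ^+ 2)%:E).
  by rewrite /= -powR_mulrn ?nrm_ge0// -powRrM mulfV// powRr1// nrm_ge0.
rewrite nrm_sqr_EFin//; apply: eq_integral => x _ /=.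
by rewrite powR_mulrn ?normr_ge0// real_normK ?num_real.
Qed.

End L2.

(** * Scaling, translation and shear of the Lebesgue measure *)

(** Packages a rescaled image measure as a measure, so that uniqueness theorems for measures apply
    to it. *)
Lemma scaled_pushforward d d' (T : measurableType d) (T' : measurableType d')
    (R : realType) (mu : {measure set T -> \bar R}) (phi : T -> T') (c : R) :
  measurable_fun [set: T] phi -> 0 <= c ->
  exists nu : {measure set T' -> \bar R},
    forall A, nu A = (c%:E * mu (phi @^-1` A))%E.
Proof.
move=> mphi c0.
pose psi : {mfun T >-> T'} := HB.pack phi (isMeasurableFun.Build _ _ _ _ phi mphi).
by unshelve eexists (mscale (NngNum c0) (pushforward mu psi)).
Qed.

Section transport.
Context d (T : measurableType d) (R : realType).
Variables (mu : {measure set T -> \bar R}) (phi : T -> T) (c : R).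
Hypotheses (mphi : measurable_fun [set: T] phi) (c_gt0 : 0 < c).
Hypothesis phiE : forall A, measurable A -> mu A = (c%:E * mu (phi @^-1` A))%E.

Let c_ge0 : 0 <= c. Proof. exact: ltW. Qed.

(** By [phiE], [mu] is [c] times its image under [phi]. This is the change of variables for a map
    with constant Jacobian [c]. *)
Lemma transport_ge0 (f : T -> \bar R) : measurable_fun [set: T] f ->
  (forall x, 0 <= f x)%E -> (\int[mu]_x f x = c%:E * \int[mu]_x f (phi x))%E.
Proof.
move=> mf f0.
rewrite (@eq_measure_integral _ _ _ _ (mscale (NngNum c_ge0) (pushforward mu phi))).
  by rewrite ge0_integral_mscale// ge0_integral_pushforward// preimage_setT.
by move=> A mA _; exact: phiE.
Qed.

Lemma transport_integrable (f : T -> R) : mu.-integrable [set: T] (EFin \o f) ->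
  mu.-integrable [set: T] (EFin \o (f \o phi)).
Proof.
move=> /integrableP[/measurable_EFinP mf fi].
have mf' : measurable_fun [set: T] (f \o phi) by exact: measurableT_comp.
apply/integrableP; split; first exact/measurable_EFinP.
rewrite -(@lte_pmul2l _ c%:E)// ?lte_fin// gt0_muley ?lte_fin//.
rewrite -(@transport_ge0 (fun y => `|(f y)%:E|%E))//.
by apply: measurableT_comp => //; exact/measurable_EFinP.
Qed.

(** The direction needed for Fubini after a shear: integrability is checked in the new variables and
    carried back. *)
Lemma transport_integrable_conv (f : T -> R) : measurable_fun [set: T] f ->
  mu.-integrable [set: T] (EFin \o (f \o phi)) ->
  mu.-integrable [set: T] (EFin \o f).
Proof.
move=> mf /integrableP[_ fi]; apply/integrableP; split.
  exact/measurable_EFinP.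
rewrite transport_ge0//; last first.
  by apply: measurableT_comp => //; exact/measurable_EFinP.
by apply: lte_mul_pinfty => //; rewrite lee_fin ltW.
Qed.

Lemma transport_Rintegral (f : T -> R) : mu.-integrable [set: T] (EFin \o f) ->
  \int[mu]_x f x = c * \int[mu]_x f (phi x).
Proof.
move=> fi; have fi' := transport_integrable fi.
have /integrableP[/measurable_EFinP mf _] := fi.
have mf' : measurable_fun [set: T] (f \o phi) by exact: measurableT_comp.
transitivity (fine (c%:E * \int[mu]_x (f (phi x))%:E)%E); last first.
  by rewrite fineM//; exact: integrable_fin_num fi'.
congr fine; rewrite [in LHS]integralE [in RHS]integralE/=.
have mE : measurable_fun [set: T] (EFin \o f) by exact/measurable_EFinP.
rewrite (@transport_ge0 ((EFin \o f)^\+)%E)//; last exact: measurable_funepos.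
rewrite (@transport_ge0 ((EFin \o f)^\-)%E)//; last exact: measurable_funeneg.
have En : (\int[mu]_x ((EFin \o f)^\- (phi x)) =
    \int[mu]_x ((EFin \o (f \o phi))^\- x))%E.
  by apply: eq_integral => x _; rewrite !unlock.
have Ep : (\int[mu]_x ((EFin \o f)^\+ (phi x)) =
    \int[mu]_x ((EFin \o (f \o phi))^\+ x))%E.
  by apply: eq_integral => x _; rewrite !unlock.
rewrite En Ep [in RHS]muleBr//.
rewrite fin_num_adde_defl// fin_numN.
exact: (integrable_neg_fin_num measurableT fi').
Qed.

Lemma transport_sqint (f : T -> R) : sqint mu f -> sqint mu (f \o phi).
Proof.
move=> [mf f2]; split; first exact: measurableT_comp.
exact: (transport_integrable f2).
Qed.

Lemma transport_ip (f g : T -> R) : sqint mu f -> sqint mu g ->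
  ip mu f g = c * ip mu (f \o phi) (g \o phi).
Proof.
by move=> sf sg; rewrite /ip (transport_Rintegral (sqint_mul sf sg)).
Qed.

End transport.

Section leb_lemmas.
Context {R : realType}.

(** Both sides are measures, and they agree on half-open intervals. *)
Lemma lebesgue_measure_affine (r y : R) (A : set (measurableTypeR R)) :
  0 < r -> measurable A ->
  lebesgue_measure A = (r%:E * lebesgue_measure ((fun x => (r * x + y)%R) @^-1` A))%E.
Proof.
move=> r0; pose phi : measurableTypeR R -> measurableTypeR R := fun x => r * x + y.
have mphi : measurable_fun [set: measurableTypeR R] phi.
  by apply: measurable_funD => //; exact: measurable_funM.
have r0' := ltW r0.
have [nu nuE] := scaled_pushforward (@lebesgue_measure R) mphi r0'.
rewrite -nuE; apply: (lebesgue_measure_unique (mu := nu)) => // X [[a b] _ <-].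
rewrite nuE.
have -> : phi @^-1` `]a, b]%classic = `](a - y) / r, (b - y) / r]%classic.
  apply/seteqP; split => x /=; rewrite !in_itv/= /phi;
    by rewrite ltr_pdivrMr// ler_pdivlMr// mulrC ltrBlDr lerBrDr mulrC.
rewrite lebesgue_measure_itv [X in (r%:E * X)%E]lebesgue_measure_itv/= !lte_fin.
rewrite ltr_pM2r ?invr_gt0// ltrD2r.
case: ifPn => _; last by rewrite mule0.
by rewrite -!EFinD -EFinM; congr EFin; field; rewrite gt_eqF.
Qed.

Lemma measurable_fun_rV_coordP d (T : measurableType d) n (f : T -> 'rV[R]_n) i :
  measurable_fun [set: T] f -> measurable_fun [set: T] (fun x => f x ord0 i).
Proof. by move=> mf; exact: (measurableT_comp (measurable_rV_coord i) mf). Qed.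

Lemma measurable_rVD d (T : measurableType d) n (f g : T -> 'rV[R]_n) :
  measurable_fun [set: T] f -> measurable_fun [set: T] g ->
  measurable_fun [set: T] (fun x => f x + g x).
Proof.
move=> mf mg; apply: measurable_fun_rVP => i.
under eq_fun do rewrite mxE.
by apply: measurable_funD; exact: measurable_fun_rV_coordP.
Qed.

Lemma measurable_rVZ d (T : measurableType d) n (a : T -> R) (f : T -> 'rV[R]_n) :
  measurable_fun [set: T] a -> measurable_fun [set: T] f ->
  measurable_fun [set: T] (fun x => a x *: f x).
Proof.
move=> ma mf; apply: measurable_fun_rVP => i.
under eq_fun do rewrite mxE.
by apply: measurable_funM => //; exact: measurable_fun_rV_coordP.
Qed.

Lemma measurable_rVB d (T : measurableType d) n (f g : T -> 'rV[R]_n) :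
  measurable_fun [set: T] f -> measurable_fun [set: T] g ->
  measurable_fun [set: T] (fun x => f x - g x).
Proof.
move=> mf mg; apply: measurable_fun_rVP => i.
under eq_fun do rewrite !mxE.
by apply: measurable_funB; exact: measurable_fun_rV_coordP.
Qed.

Lemma measurable_enorm n : measurable_fun [set: 'rV[R]_n] (@enorm R n).
Proof.
apply: measurableT_comp.
  by apply: continuous_measurable_fun; exact: sqrt_continuous.
apply: measurable_sum => i; apply: measurable_funM; exact: measurable_rV_coord.
Qed.

(** Induction on the dimension. The map acts on each coordinate separately, so preimages of
    rectangles are rectangles, and uniqueness of the product measure reduces the claim to the
    one-dimensional factor and the induction hypothesis. *)
Lemma leb_affine n (r : R) (y : 'rV[R]_n) (A : set 'rV[R]_n) :
  0 < r -> measurable A ->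
  leb n A = ((r ^+ n)%:E * leb n ((fun x => r *: x + y)%R @^-1` A))%E.
Proof.
move=> r0; elim: n => [|n IHn] in y A *.
  move=> mA; rewrite expr0 mul1e; congr (leb 0 _).
  have E0 (x z : 'rV[R]_0) : x = z by apply/rowP; case.
  by apply/seteqP; split => x /=; rewrite (E0 (r *: x + y) x).
move=> mA.
pose y2 : 'rV[R]_n := \row_(j < n) y ord0 (lift ord0 j).
pose f1 (x : measurableTypeR R) : measurableTypeR R := r * x + y ord0 ord0.
pose f2 (x : 'rV[R]_n) : 'rV[R]_n := r *: x + y2.
pose phi (p : measurableTypeR R * 'rV[R]_n) : measurableTypeR R * 'rV[R]_n :=
  (f1 p.1, f2 p.2).
have m2 : measurable_fun [set: 'rV[R]_n] f2.
  by apply: measurable_rVD => //; exact: measurable_rVZ.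
have m1 : measurable_fun [set: measurableTypeR R] f1.
  by apply: measurable_funD => //; exact: measurable_funM.
have mphi : measurable_fun [set: measurableTypeR R * 'rV[R]_n] phi.
  by apply/measurable_fun_pairP; split;
    [exact: (measurableT_comp m1 measurable_fst)|
     exact: (measurableT_comp m2 measurable_snd)].
have r0' : 0 <= r ^+ n.+1 by rewrite exprn_ge0// ltW.
have [nu nuE] := scaled_pushforward (@lebesgue_measure R \x leb n)%E mphi r0'.
have lebS B : leb n.+1 B = (@lebesgue_measure R \x leb n)%E (@rV_cons R n @^-1` B).
  by [].
rewrite !lebS (product_measure_unique (m' := nu)); last 2 first.
- move=> B C mB mC; rewrite nuE.
  have -> : phi @^-1` (B `*` C) = (f1 @^-1` B) `*` (f2 @^-1` C).
    by apply/seteqP; split => -[].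
  have m1B : measurable (f1 @^-1` B).
    by rewrite -[X in measurable X]setTI; exact: m1.
  have m2C : measurable (f2 @^-1` C).
    by rewrite -[X in measurable X]setTI; exact: m2.
  have PE := product_measure1E (@lebesgue_measure R) (leb n) m1B m2C.
  transitivity ((r ^+ n.+1)%:E *
      (lebesgue_measure (f1 @^-1` B) * leb n (f2 @^-1` C)))%E.
    by congr (_ * _)%E; exact: PE.
  transitivity (r%:E * lebesgue_measure (f1 @^-1` B) *
      ((r ^+ n)%:E * leb n (f2 @^-1` C)))%E; last first.
    apply: esym; congr (_ * _)%E; last exact: IHn.
    exact: lebesgue_measure_affine.
  rewrite exprS EFinM !muleA; congr (_ * _)%E; rewrite -!muleA.
  by congr (_ * _)%E; rewrite muleC.
- by rewrite -[X in measurable X]setTI; exact: measurable_rV_cons.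
rewrite nuE; congr (_ * _)%E; apply: congr1.
have E p : rV_cons (phi p) = r *: rV_cons p + y.
  apply/rowP => i; rewrite /rV_cons !mxE /phi/f1/f2/=.
  by case: unliftP => [j ->|->] /=; rewrite ?mxE.
by apply/seteqP; split => p /=; rewrite E.
Qed.

Lemma measurable_fun_affine n (r : R) (y : 'rV[R]_n) :
  measurable_fun [set: 'rV[R]_n] (fun x => r *: x + y).
Proof. by apply: measurable_rVD => //; exact: measurable_rVZ. Qed.

Definition shear n (z : 'rV[R]_n * 'rV[R]_n) : 'rV[R]_n * 'rV[R]_n :=
  (z.1, z.1 + z.2).

Lemma measurable_shear n : measurable_fun [set: 'rV[R]_n * 'rV[R]_n] (@shear n).
Proof.
apply/measurable_fun_pairP; split; first exact: measurable_fst.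
exact: measurable_rVD measurable_fst measurable_snd.
Qed.

(** For fixed [x] the shear is a translation of the second variable, so each section keeps its
    measure. The factor 1 gives the statement the shape of [phiE]. *)
Lemma leb_shear n (A : set ('rV[R]_n * 'rV[R]_n)) : measurable A ->
  (leb n \x leb n)%E A = (1%:E * (leb n \x leb n) (@shear n @^-1` A))%E.
Proof.
move=> mA; rewrite mul1e /product_measure1; apply: eq_integral => x _ /=.
rewrite (leb_affine x ltr01) ?expr1n ?mul1e; last exact: measurable_xsection.
congr (leb n _); apply/seteqP; split => y /=; rewrite !xsectionE /= scale1r addrC //.
Qed.

End leb_lemmas.

(** * Correlations of increments *)

Lemma integrable_indic_fin d (T : measurableType d) (R : realType)
    (mu : {measure set T -> \bar R}) (A : set T) :
  measurable A -> (mu A < +oo)%E ->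
  mu.-integrable [set: T] (EFin \o (\1_A : T -> R)).
Proof.
move=> mA Aoo; apply/integrableP; split; first exact/measurable_EFinP.
under eq_integral do rewrite gee0_abs ?lee_fin//.
by rewrite integral_indic// setIT.
Qed.

Lemma bounded_integral d (T : measurableType d) (R : realType)
    (mu : {measure set T -> \bar R}) (A : set T) (f : T -> R) (M : R) :
  measurable A -> (mu A < +oo)%E -> measurable_fun [set: T] f ->
  (forall x, `|f x| <= M * \1_A x) ->
  mu.-integrable [set: T] (fun x => (f x)%:E) /\
  `|\int[mu]_x f x| <= M * fine (mu A).
Proof.
move=> mA Aoo mf fM.
have iA : mu.-integrable [set: T] (EFin \o (\1_A : T -> R)).
  exact: integrable_indic_fin.
have iM : mu.-integrable [set: T] (EFin \o (fun x => M * \1_A x)).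
  exact: (integrableZl measurableT M iA).
have fi : mu.-integrable [set: T] (EFin \o f).
  apply: (le_integrable measurableT _ _ iM); first exact/measurable_EFinP.
  move=> x _ /=; rewrite lee_fin; apply: (le_trans (fM x)).
  exact: ler_norm.
split => //.
apply: (le_trans (le_normr_Rintegral measurableT fi)).
have fi' : mu.-integrable [set: T] (EFin \o (fun x => `|f x|)).
  exact: (integrable_norm fi).
apply: (le_trans (le_Rintegral measurableT fi' iM _)); first by [].
by rewrite RintegralZl// /Rintegral integral_indic// setIT.
Qed.

Section correlation.
Context {R : realType} {n : nat}.
Local Notation X := 'rV[R]_n.
Implicit Types (u v : X -> R) (y z : X).

Definition tr y u : X -> R := fun x => u (x + y).

Definition corr u v y : R := ip (leb n) (u \- tr y u) (v \- tr y v).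

Lemma leb_translation y (A : set X) : measurable A ->
  leb n A = (1%:E * leb n ((fun x => (x + y)%R) @^-1` A))%E.
Proof.
move=> mA; rewrite {1}(leb_affine y ltr01 mA) expr1n.
by under [in RHS]eq_fun do rewrite -[X in (X + _)%R]scale1r.
Qed.

Lemma measurable_translation y : measurable_fun [set: X] (fun x : X => x + y).
Proof. by apply: measurable_rVD. Qed.

Lemma tr_sqint y u : sqint (leb n) u -> sqint (leb n) (tr y u).
Proof.
exact: (transport_sqint (measurable_translation y) ltr01 (leb_translation y)).
Qed.

Lemma ip_tr y u v : sqint (leb n) u -> sqint (leb n) v ->
  ip (leb n) (tr y u) (tr y v) = ip (leb n) u v.
Proof.
move=> su sv; rewrite [RHS](transport_ip (measurable_translation y) ltr01
  (leb_translation y) su sv).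
by rewrite mul1r.
Qed.

Lemma nrm_tr y u : sqint (leb n) u -> nrm (leb n) (tr y u) = nrm (leb n) u.
Proof. by move=> su; rewrite /nrm ip_tr. Qed.

Lemma nrm_subtr_le y u : sqint (leb n) u ->
  nrm (leb n) (u \- tr y u) <= 2 * nrm (leb n) u.
Proof.
move=> su; have := nrmB su (tr_sqint y su).
by rewrite nrm_tr// -mulr2n mulr_natl.
Qed.

Lemma corr_bound u v y : sqint (leb n) u -> sqint (leb n) v ->
  `|corr u v y| <= 4 * (nrm (leb n) u * nrm (leb n) v).
Proof.
move=> su sv; have su' := sqintB su (tr_sqint y su).
have sv' := sqintB sv (tr_sqint y sv).
apply: (le_trans (cauchy_schwarz su' sv')).
have := ler_pM (nrm_ge0 _ _) (nrm_ge0 _ _) (nrm_subtr_le y su) (nrm_subtr_le y sv).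
by rewrite mulrACA -natrM.
Qed.

(** Translation invariance moves every shift from [v] to [u], so that regularity in [y] can be read
    off [u] alone. *)
Lemma corrE u v y : sqint (leb n) u -> sqint (leb n) v ->
  corr u v y =
  2 * ip (leb n) u v - ip (leb n) (tr (- y) u) v - ip (leb n) (tr y u) v.
Proof.
move=> su sv; have su' := tr_sqint y su; have sv' := tr_sqint y sv.
have suN := tr_sqint (- y) su.
rewrite /corr ipBl//; last exact: sqintB.
rewrite !ipBr// ip_tr//.
have -> : ip (leb n) u (tr y v) = ip (leb n) (tr (- y) u) v.
  rewrite -(ip_tr y suN sv); congr (ip _ _ _).
  by apply/funext => x; rewrite /tr addrK.
ring.
Qed.

Lemma nrm_tr2 u y z : sqint (leb n) u ->
  nrm (leb n) (tr y u \- tr z u) = nrm (leb n) (u \- tr (z - y) u).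
Proof.
move=> su; have su' := tr_sqint (z - y) su.
rewrite -[RHS](nrm_tr y (sqintB su su')); congr (nrm _ _).
by apply/funext => x; rewrite /tr /= -addrA (addrC y) subrK.
Qed.

(** The factor 2 counts the two shifted terms of [corrE]. Symmetry of the distance is a hypothesis
    here because [enormBC] is proved further down. *)
Lemma corr_lip u v y z (M : R) : sqint (leb n) u -> sqint (leb n) v ->
  (forall w, nrm (leb n) (u \- tr w u) <= M * enorm w) ->
  enorm (z - y) = enorm (y - z) ->
  `|corr u v y - corr u v z| <= 2 * (M * enorm (y - z) * nrm (leb n) v).
Proof.
move=> su sv uM zy; rewrite !corrE//.
have H a b : `|ip (leb n) (tr a u) v - ip (leb n) (tr b u) v| <=
    M * enorm (b - a) * nrm (leb n) v.
  have sa := tr_sqint a su; have sb := tr_sqint b su.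
  rewrite -ipBl//; apply: le_trans (cauchy_schwarz (sqintB sa sb) sv) _.
  by rewrite ler_wpM2r ?nrm_ge0// nrm_tr2.
have H1 := H z y; have H2 := H (- z) (- y).
rewrite opprK (addrC (- y)) zy in H2.
move: H1 H2; rewrite !ler_norml => /andP[h1 h2] /andP[h3 h4].
by apply/andP; split; lra.
Qed.

Lemma measurable_diff_prod u : measurable_fun [set: X] u ->
  measurable_fun [set: X * X] (fun z : X * X => u z.1 - u z.2).
Proof.
move=> mu; apply: measurable_funB.
  exact: (measurableT_comp mu measurable_fst).
exact: (measurableT_comp mu measurable_snd).
Qed.

(** A partial integral of a jointly measurable function. Tonelli measurability concerns nonnegative
    functions, hence the split into positive and negative parts. *)
Lemma measurable_corr u v : measurable_fun [set: X] u ->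
  measurable_fun [set: X] v -> measurable_fun [set: X] (corr u v).
Proof.
move=> mu mv.
pose f (z : X * X) := ((u z.1 - tr z.2 u z.1) * (v z.1 - tr z.2 v z.1))%:E.
have mf : measurable_fun [set: X * X] f.
  apply/measurable_EFinP; apply: measurable_funM.
    exact: (measurableT_comp (measurable_diff_prod mu) (@measurable_shear R n)).
  exact: (measurableT_comp (measurable_diff_prod mv) (@measurable_shear R n)).
rewrite (_ : corr u v = fine \o
   ((fubini_G (leb n) f^\+ \- fubini_G (leb n) f^\-)%E)); last first.
  apply/funext => y; rewrite /corr /ip /Rintegral/=; congr fine.
  by rewrite integralE; congr (_ - _)%E; apply: eq_integral => x _;
    rewrite ?funeposE ?funenegE.
apply: measurableT_comp => //.
by apply: emeasurable_funB; apply: measurable_fun_fubini_tonelli_G => //;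
  [exact: measurable_funepos|exact: measurable_funeneg].
Qed.

(** After the shear the kernel depends on [y] alone. Integrating in [x] first leaves a bounded
    function of [y] supported in [A]; this gives integrability, and then Fubini gives the
    identity. *)
Lemma conv_form (K : X -> R) (A : set X) (C : R) u v :
  measurable_fun [set: X] K -> measurable A -> (leb n A < +oo)%E ->
  (forall y, `|K y| <= C * \1_A y) ->
  sqint (leb n) u -> sqint (leb n) v ->
  let W (z : X * X) := K (z.2 - z.1) * ((u z.1 - u z.2) * (v z.1 - v z.2)) in
  (leb n \x leb n)%E.-integrable [set: X * X] (EFin \o W) /\
  \int[(leb n \x leb n)%E]_z W z = \int[leb n]_y (K y * corr u v y).
Proof.
move=> mK mA Aoo KC su sv W.
have [mu _] := su; have [mv _] := sv.
have mW : measurable_fun [set: X * X] W.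
  apply: measurable_funM.
    by apply: (measurableT_comp mK); exact: measurable_rVB.
  by apply: measurable_funM; exact: measurable_diff_prod.
have mS := @measurable_shear R n.
have mWS : measurable_fun [set: X * X] (W \o @shear R n) by exact: measurableT_comp.
have WSE x y : W (shear (x, y)) = K y * ((u \- tr y u) x * (v \- tr y v) x).
  by rewrite /W /shear/= (addrC x) addrK /tr (addrC y).
have iWS : (leb n \x leb n)%E.-integrable [set: X * X] (EFin \o (W \o @shear R n)).
  apply/integrable21ltyP; first exact/measurable_EFinP.
  (* Pointwise |a b| <= a^2 + b^2, and each increment has norm at most twice that of the function,
     which gives 4 after squaring. *)
  pose B := 4 * (nrm (leb n) u ^+ 2 + nrm (leb n) v ^+ 2).
  have H y : (\int[leb n]_x `|(W (shear (x, y)))%:E| <= (C * B * \1_A y)%:E)%E.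
    have su' := sqintB su (tr_sqint y su); have sv' := sqintB sv (tr_sqint y sv).
    have iuv := sqint_mul su' sv'.
    have mWy : measurable_fun [set: X] (fun x => W (shear (x, y))).
      under eq_fun do rewrite WSE.
      apply: measurable_funM; first exact: measurable_cst.
      by apply: measurable_funM; [exact: su'.1|exact: sv'.1].
    apply: (@le_trans _ _ (\int[leb n]_x ((C * \1_A y)%:E *
       (((u \- tr y u) x ^+ 2)%:E + ((v \- tr y v) x ^+ 2)%:E)))%E).
      apply: ge0_le_integral => //.
      - by apply/measurable_EFinP; apply: measurableT_comp.
      - apply/measurable_EFinP; apply: measurable_funM => //.
        by apply: measurable_funD; apply: measurable_funX;
          [exact: su'.1|exact: sv'.1].
      - move=> x _; rewrite -EFinD -EFinM lee_fin WSE normrM.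
        apply: ler_pM => //; rewrite normrM -[X in _ <= X + _]real_normK ?num_real//.
        rewrite -[X in _ <= _ + X]real_normK ?num_real//.
        move: (`|_|) (`|_|) (normr_ge0 ((u \- tr y u) x))
          (normr_ge0 ((v \- tr y v) x)) => a b a0 b0; nra.
    have [_ iu] := su'; have [_ iv] := sv'.
    rewrite integralZl//; last exact: integrableD.
    rewrite integralD// -!nrm_sqr_EFin// -EFinD -EFinM lee_fin.
    rewrite [C * B * _]mulrAC; apply: ler_wpM2l; first by apply: le_trans (KC y).
    rewrite /B mulrDr; apply: lerD.
      have := nrm_subtr_le y su; have := nrm_ge0 (leb n) (u \- tr y u).
      have := nrm_ge0 (leb n) u; nra.
    have := nrm_subtr_le y sv; have := nrm_ge0 (leb n) (v \- tr y v).
    have := nrm_ge0 (leb n) v; nra.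
  apply: (@le_lt_trans _ _ (\int[leb n]_y (C * B * \1_A y)%:E)%E).
    apply: ge0_le_integral => //.
    - by move=> y _; exact: integral_ge0.
    - have := @measurable_fun_fubini_tonelli_G _ _ _ _ _ (leb n)
        (abse \o (EFin \o (W \o @shear R n))); apply => //.
      by apply: measurableT_comp => //; apply: measurableT_comp.
      by move=> z; exact: abse_ge0.
    - by apply/measurable_EFinP; apply: measurable_funM.
    - by move=> y _; exact: H.
  have iA : (leb n).-integrable [set: X] (EFin \o (\1_A : X -> R)).
    exact: integrable_indic_fin.
  have /integrableP[_] := integrableZl measurableT (C * B) iA.
  apply: le_lt_trans; rewrite le_eqVlt; apply/orP; left; apply/eqP.
  apply: eq_integral => y _; rewrite gee0_abs//= lee_fin.
  by rewrite -lee_fin; apply: le_trans (H y); exact: integral_ge0.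
have iW := transport_integrable_conv mS ltr01 (@leb_shear R n) mW iWS.
split => //.
rewrite (transport_Rintegral mS ltr01 (@leb_shear R n) iW) mul1r.
rewrite /Rintegral; congr fine.
rewrite -(integral21_prod_meas1 iWS); apply: eq_integral => y _.
rewrite /fubini_G/= EFinM /corr ip_EFin; last 2 first.
- exact: sqintB su (tr_sqint y su).
- exact: sqintB sv (tr_sqint y sv).
rewrite -integralZl//; last first.
  by apply: sqint_mul; [exact: sqintB su (tr_sqint y su)|
                        exact: sqintB sv (tr_sqint y sv)].
by apply: eq_integral => x _; rewrite WSE EFinM.
Qed.

End correlation.

(** * Balls and shells *)

Section polar.
Context {R : realType} {n : nat}.
Local Notation X := 'rV[R]_n.
Implicit Types (x y : X) (r s t : R).

Definition eball r : set X := [set y | enorm y <= r].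

Definition cube r : set X := [set x | forall i, `|x ord0 i| <= r].

Definition shell s t : set X := [set y | s < enorm y <= t].

Definition omega : R := fine (leb n (eball 1)).

Lemma dotv_ge0 x : 0 <= dotv x x.
Proof. by apply: sumr_ge0 => i _; rewrite -expr2 sqr_ge0. Qed.

Lemma enorm_ge0 x : 0 <= enorm x. Proof. exact: sqrtr_ge0. Qed.

Lemma enormZ r x : enorm (r *: x) = `|r| * enorm x.
Proof.
rewrite /enorm (_ : dotv _ _ = r ^+ 2 * dotv x x).
  by rewrite sqrtrM ?sqr_ge0// sqrtr_sqr.
by rewrite /dotv mulr_sumr; apply: eq_bigr => i _; rewrite !mxE; ring.
Qed.

Lemma enormN x : enorm (- x) = enorm x.
Proof. by rewrite -scaleN1r enormZ normrN1 mul1r. Qed.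

Lemma enormBC x y : enorm (x - y) = enorm (y - x).
Proof. by rewrite -enormN opprB. Qed.

Lemma coord_le_enorm x i : `|x ord0 i| <= enorm x.
Proof.
rewrite -sqrtr_sqr ler_sqrt ?dotv_ge0// /dotv (bigD1 i)//= -expr2 lerDl.
by apply: sumr_ge0 => j _; rewrite -expr2 sqr_ge0.
Qed.

Lemma measurable_eball r : measurable (eball r).
Proof.
rewrite -[X in measurable X]setTI (_ : eball r = (@enorm R n) @^-1` `]-oo, r]).
  exact: measurable_enorm.
by apply/seteqP; split => x /=; rewrite in_itv.
Qed.

Lemma measurable_shell s t : measurable (shell s t).
Proof.
rewrite -[X in measurable X]setTI (_ : shell s t = (@enorm R n) @^-1` `]s, t]).
  exact: measurable_enorm.
by apply/seteqP; split => x /=; rewrite in_itv.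
Qed.

Lemma measurable_cube r : measurable (cube r).
Proof.
rewrite (_ : cube r = \bigcap_(i in [set: 'I_n]) (@rV_coord R n i @^-1` `[- r, r])).
  apply: fin_bigcap_measurable => // i _.
  by rewrite -[X in measurable X]setTI; exact: measurable_rV_coord.
apply/seteqP; split => x /= h i; first
  by move=> _; rewrite /= in_itv/= -ler_norml; exact: h.
by have := h i Logic.I; rewrite /= in_itv/= -ler_norml.
Qed.

Lemma leb_cube_lty r : (leb n (cube r) < +oo)%E.
Proof.
rewrite (_ : cube r = [set x : X | forall i, `[- r, r]%classic (x ord0 i)]).
  rewrite (@leb_box R n (fun=> `[- r, r]%classic))//.
  apply: (proj2 (big_ind (fun x : \bar R => (0 <= x)%E /\ (x < +oo)%E) _ _ _)).
  - by split; rewrite ?lee_fin ?ltry.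
  - move=> a b [a0 aoo] [b0 boo]; split; first exact: mule_ge0.
    by rewrite lte_mul_pinfty// ge0_fin_numE.
  - move=> i _; split; first exact: measure_ge0.
    rewrite lebesgue_measure_itv/=.
    by case: ifP => _; rewrite ?ltry// -EFinB ltry.
by apply/seteqP; split => x /= h i; have := h i; rewrite in_itv/= ler_norml.
Qed.

Lemma leb_eball_lty r : (leb n (eball r) < +oo)%E.
Proof.
apply: le_lt_trans (leb_cube_lty r); apply: le_measure; rewrite ?inE.
- exact: measurable_eball.
- exact: measurable_cube.
- by move=> x /= xr i; apply: le_trans xr; exact: coord_le_enorm.
Qed.

Lemma leb_shell_lty s t : (leb n (shell s t) < +oo)%E.
Proof.
apply: le_lt_trans (leb_eball_lty t); apply: le_measure; rewrite ?inE.
- exact: measurable_shell.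
- exact: measurable_eball.
- by move=> x /andP[].
Qed.

Lemma omega_ge0 : 0 <= omega. Proof. by rewrite fine_ge0. Qed.

Lemma indic_shell s t x : s <= t ->
  \1_(shell s t) x = \1_(eball t) x - \1_(eball s) x :> R.
Proof.
have inE' (P : pred X) y : (y \in [set z | P z]) = P y.
  by apply/idP/idP; rewrite inE.
move=> st; rewrite !indicE !inE'.
have [xs|xs] := leP (enorm x) s => /=; first by rewrite (le_trans xs st) subrr.
by rewrite subr0.
Qed.

(** * Functions that are constant along rays *)

Section cone.
Variables (g : X -> R) (C : R).
Hypotheses (mg : measurable_fun [set: X] g) (gC : forall x, `|g x| <= C).
Hypothesis g_cone : forall r x, 0 < r -> g (r *: x) = g x.

Lemma indicM_integrable (A : set X) (f : X -> R) : measurable A ->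
  (leb n A < +oo)%E -> measurable_fun [set: X] f ->
  (forall x, A x -> `|f x| <= C) ->
  (leb n).-integrable [set: X] (EFin \o (fun x => \1_A x * f x)) /\
  `|\int[leb n]_x (\1_A x * f x)| <= C * fine (leb n A).
Proof.
move=> mA Aoo mf fC; apply: bounded_integral => //.
  exact: measurable_funM.
move=> x; rewrite indicE normrM; have [|_] := boolP (x \in A).
  by rewrite inE => /fC; rewrite normr1 mul1r mulr1.
by rewrite normr0 mul0r mulr0.
Qed.

(* [g] is constant along rays, so scaling by [r] only produces the Jacobian. *)
Lemma cone_eball r : 0 < r -> \int[leb n]_x (\1_(eball r) x * g x) =
  r ^+ n * \int[leb n]_x (\1_(eball 1) x * g x).
Proof.
move=> r0; have [ig _] := indicM_integrable (measurable_eball r)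
  (leb_eball_lty r) mg (fun x _ => gC x).
rewrite (transport_Rintegral (@measurable_fun_affine R n r 0) _
  (fun A => leb_affine 0 r0) ig) ?exprn_gt0//.
congr (_ * Rintegral _ _ _); apply/funext => x; rewrite addr0 g_cone//.
congr (_ * _); rewrite !indicE; congr (nat_of_bool _)%:R.
have E : (r * enorm x <= r) = (enorm x <= 1) by rewrite -{2}[r]mulr1 ler_pM2l.
by apply/idP/idP; rewrite !inE /eball/= enormZ gtr0_norm// E.
Qed.

Lemma cone_shell s t : 0 < s -> s <= t ->
  \int[leb n]_x (\1_(shell s t) x * g x) =
  (t ^+ n - s ^+ n) * \int[leb n]_x (\1_(eball 1) x * g x).
Proof.
move=> s0 st; have t0 := lt_le_trans s0 st.
rewrite mulrBl -!cone_eball// -RintegralB//.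
- congr (Rintegral _ _ _); apply/funext => x.
  by rewrite indic_shell// mulrBl.
- exact: (indicM_integrable (measurable_eball t)
    (leb_eball_lty t) mg (fun x _ => gC x)).1.
- exact: (indicM_integrable (measurable_eball s)
    (leb_eball_lty s) mg (fun x _ => gC x)).1.
Qed.

End cone.

(** The case g = 1 of [cone_shell]. *)
Lemma leb_shell s t : 0 < s -> s <= t ->
  fine (leb n (shell s t)) = (t ^+ n - s ^+ n) * omega.
Proof.
move=> s0 st.
have E (A : set X) : measurable A -> fine (leb n A) = \int[leb n]_x (\1_A x * cst 1 x).
  move=> mA; under eq_Rintegral do rewrite mulr1.
  by rewrite /Rintegral integral_indic// setIT.
rewrite /omega (E _ (measurable_shell s t)) (E _ (measurable_eball 1)).
by apply: (@cone_shell _ 1) => // x; rewrite normr1.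
Qed.

(** A substitute for polar coordinates. If [g] is constant along rays, its integral over the shell
    is exact by [cone_shell], and replacing [G] by [g] costs at most [L] times the volume of the
    shell. *)
Lemma polar_shell (G g : X -> R) (C L s t : R) : 0 < s -> s <= t ->
  measurable_fun [set: X] G -> measurable_fun [set: X] g ->
  (forall x, `|g x| <= C) -> (forall r x, 0 < r -> g (r *: x) = g x) ->
  (forall x, shell s t x -> `|G x - g x| <= L) ->
  `|\int[leb n]_x (\1_(shell s t) x * G x) -
    (t ^+ n - s ^+ n) * \int[leb n]_x (\1_(eball 1) x * g x)| <=
  L * ((t ^+ n - s ^+ n) * omega).
Proof.
move=> s0 st mG mg gC gcone GgL.
have [mS Soo] := (measurable_shell s t, leb_shell_lty s t).
have [ig _] := indicM_integrable mS Soo mg (fun x _ => gC x).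
have mGg : measurable_fun [set: X] (G \- g) by exact: measurable_funB.
have [iGg le] := indicM_integrable mS Soo mGg GgL.
rewrite -(cone_shell mg gC gcone s0 st) -leb_shell//; apply: le_trans le.
rewrite le_eqVlt; apply/orP; left; apply/eqP; congr `|_|.
have iG : (leb n).-integrable [set: X] (EFin \o (fun x => \1_(shell s t) x * G x)).
  have := integrableD measurableT iGg ig; apply: eq_integrable => // x _ /=.
  by rewrite -EFinD; congr EFin; ring.
rewrite -RintegralB//; congr (Rintegral _ _ _); apply/funext => x /=; ring.
Qed.

End polar.

(** * Integrals over shells *)

Section power_slope.
Context {R : realFieldType}.
Implicit Types s t : R.

(* The divided difference of x ^+ n. *)
Fixpoint xslope n s t : R :=
  if n is m.+1 then t * xslope m s t + s ^+ m else 0.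

Lemma xslopeE n s t : t ^+ n - s ^+ n = (t - s) * xslope n s t.
Proof.
elim: n => [|n IH] /=; first by rewrite !expr0 subrr mulr0.
rewrite mulrDr mulrCA -IH !exprS; ring.
Qed.

Lemma expr_lip (D : R) n : 0 <= D -> exists2 c : R, 0 <= c &
  forall s t, 0 <= s <= D -> 0 <= t <= D ->
    0 <= s ^+ n <= c /\ `|s ^+ n - t ^+ n| <= c * `|s - t|.
Proof.
move=> D0; elim: n => [|n [c c0 IH]].
  exists 1 => // s t _ _; rewrite !expr0 subrr normr0 mul1r.
  by split; [rewrite ler01 lexx|].
exists (D * c + c); first by rewrite addr_ge0// mulr_ge0.
move=> s t sD tD; have [/andP[s1 s2] st] := IH s t sD tD.
case/andP: sD => s0 sD; case/andP: tD => t0 tD.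
rewrite !exprS; split.
  apply/andP; split; first exact: mulr_ge0.
  by rewrite (le_trans (ler_pM s0 s1 sD s2))// lerDl.
have -> : s * s ^+ n - t * t ^+ n = t * (s ^+ n - t ^+ n) + (s - t) * s ^+ n by ring.
rewrite (le_trans (ler_normD _ _))// !normrM (ger0_norm t0) (ger0_norm s1) mulrDl.
apply: lerD; last by rewrite mulrC ler_wpM2r.
by rewrite -mulrA ler_pM.
Qed.

(** The recursion defining [xslope] contains no division by [t - s], so its bounds are uniform up to
    [s = t]. *)
Lemma xslope_lip (D : R) n : 0 <= D -> exists2 c : R, 0 <= c &
  forall s t s' t', 0 <= s <= D -> 0 <= t <= D -> 0 <= s' <= D -> 0 <= t' <= D ->
    0 <= xslope n s t <= c /\
    `|xslope n s t - xslope n s' t'| <= c * (`|s - s'| + `|t - t'|).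
Proof.
move=> D0; elim: n => [|n [c c0 IH]].
  exists 0 => // s t s' t' _ _ _ _ /=; rewrite lexx subrr normr0 mul0r.
  by split.
have [b b0 Hb] := expr_lip n D0.
exists (D * c + c + b); first by rewrite !addr_ge0// mulr_ge0.
move=> s t s' t' sD tD s'D t'D /=.
have [/andP[x1 x2] st] := IH s t s' t' sD tD s'D t'D.
have [/andP[s1 s2] ss] := Hb s s' sD s'D.
case/andP: tD => t0 tD; case/andP: t'D => t'0 t'D.
split.
  apply/andP; split; first by rewrite addr_ge0// mulr_ge0.
  by rewrite lerD// (le_trans (ler_pM t0 x1 tD x2))// lerDl.
have -> : t * xslope n s t + s ^+ n - (t' * xslope n s' t' + s' ^+ n) =
  t' * (xslope n s t - xslope n s' t') + (t - t') * xslope n s t +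
  (s ^+ n - s' ^+ n) by ring.
rewrite (le_trans (ler_normD _ _))// (mulrDl (D * c + c)) (mulrDl (D * c)).
apply: lerD; last by rewrite (le_trans ss)// ler_wpM2l// lerDl.
rewrite (le_trans (ler_normD _ _))//; apply: lerD.
  by rewrite normrM (ger0_norm t'0) -mulrA ler_pM.
rewrite normrM (ger0_norm x1) mulrC ler_pM// lerDr//.
Qed.

(** Final arithmetic of [shell_form_slope_lip]: [U] and [V] stand for the L^2 norms of u and v, [c]
    for the constant of [xslope_lip], [o] for the volume of the unit ball, and e1, ..., e4 for t -
    s, t' - s', |s - s'|, |t - t'|. The difference of the two sides is a polynomial with nonnegative
    coefficients. *)
Lemma slope_bound_algebra (Gam Kl M U V c o e1 e2 e3 e4 : R) :
  0 <= Gam -> 0 <= Kl -> 0 <= M -> 0 <= U -> 0 <= V -> 0 <= c -> 0 <= o ->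
  0 <= e1 -> 0 <= e2 -> 0 <= e3 -> 0 <= e4 ->
  (4 * Kl * U + 2 * Gam * M) * V * e1 * (c * o) +
  (4 * Kl * U + 2 * Gam * M) * V * e2 * (c * o) +
  (c * (e3 + e4) * (Gam * (4 * (U * V)) * o) +
   c * ((4 * Kl * U + 2 * Gam * M) * V * e3 * o)) <=
  4 * (Gam + Kl) * (c * o) * (e1 + e2 + e3 + e4) * ((U + M) * V).
Proof.
move=> G0 K0 M0 U0 V0 c0 o0 e10 e20 e30 e40.
have h1 : 0 <= Gam * M by rewrite mulr_ge0.
have h2 : 0 <= Kl * U by rewrite mulr_ge0.
have h3 : 0 <= Gam * U by rewrite mulr_ge0.
have h4 : 0 <= Kl * M by rewrite mulr_ge0.
rewrite -subr_ge0 (_ : _ - _ = (c * o * V) *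
  ((4 * (Gam * U) + 2 * (Gam * M) + 4 * (Kl * M)) *
   (e1 + e2) + (2 * (Gam * M) + 4 * (Kl * M)) * e3 +
   (4 * (Gam * M) + 4 * (Kl * M) + 4 * (Kl * U)) * e4)); last by ring.
by do ?[apply: mulr_ge0 | apply: addr_ge0].
Qed.

End power_slope.

(** * Correlations integrated over a shell *)

Section shell_form.
Context {R : realType} {n : nat}.
Local Notation X := 'rV[R]_n.
Variables (dmin dmax : R) (gamh : R -> R) (Gam Kl : R).
Hypotheses (dmin_gt0 : 0 < dmin) (dmin_dmax : dmin <= dmax).
Hypothesis gamh_meas : measurable_fun [set: X] (fun y : X => gamh (enorm y)).
Hypotheses (Gam_ge0 : 0 <= Gam) (Kl_ge0 : 0 <= Kl).
Hypothesis gamh_bound : forall a, dmin <= a <= dmax -> `|gamh a| <= Gam.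
Hypothesis gamh_lip : forall a b, dmin <= a <= dmax -> dmin <= b <= dmax ->
  `|gamh a - gamh b| <= Kl * `|a - b|.
Implicit Types (u v : X -> R) (s t : R).
Local Notation L2n := (nrm (@leb R n)).
Local Notation inL2 := (sqint (@leb R n)).
Local Notation om := (@omega R n).

Definition shell_kernel s t (y : X) : R := \1_(shell s t) y * gamh (enorm y).

(** This is a(u, v; t) - a(u, v; s), as [energy_shell] shows. *)
Definition shell_form s t u v : R :=
  \int[leb n]_y (shell_kernel s t y * corr u v y).

(* [s / enorm w *: w] is the radial projection of [w] to the sphere of radius [s],
   so up to the factor n this is an integral over the unit sphere; no surface
   measure is needed. *)
Definition sphere_mean s u v : R :=
  \int[leb n]_w (\1_(eball 1) w * (gamh s * corr u v ((s / enorm w) *: w))).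

Lemma shell_kernel_meas s t : measurable_fun [set: X] (shell_kernel s t).
Proof.
by apply: measurable_funM => //; apply: measurable_indic; exact: measurable_shell.
Qed.

Lemma shell_kernel_bound s t y : dmin <= s -> t <= dmax ->
  `|shell_kernel s t y| <= Gam * \1_(shell s t) y.
Proof.
move=> sd td; rewrite /shell_kernel indicE; have [|_] := boolP (y \in _).
  rewrite inE => /andP[sy yt]; rewrite mul1r mulr1; apply: gamh_bound.
  by rewrite (le_trans sd (ltW sy)) (le_trans yt).
by rewrite mul0r normr0 mulr0.
Qed.

Lemma shell_formE s t u v : shell_form s t u v =
  \int[leb n]_y (\1_(shell s t) y * (gamh (enorm y) * corr u v y)).
Proof. by congr (Rintegral _ _ _); apply/funext => y; rewrite mulrA. Qed.

Lemma shell_form_bound s t u v : inL2 u -> inL2 v -> dmin <= s -> s <= t ->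
  t <= dmax ->
  `|shell_form s t u v| <= Gam * (4 * (L2n u * L2n v)) * ((t ^+ n - s ^+ n) * om).
Proof.
move=> su sv sd st td.
rewrite shell_formE -leb_shell//; last exact: lt_le_trans dmin_gt0 sd.
apply: (proj2 (indicM_integrable (measurable_shell s t) (leb_shell_lty s t) _ _)).
  by apply: measurable_funM => //; apply: measurable_corr; [case: su|case: sv].
move=> y /andP[sy yt]; rewrite normrM ler_pM//.
  by apply: gamh_bound; rewrite (le_trans sd (ltW sy)) (le_trans yt).
exact: corr_bound.
Qed.

Lemma measurable_radial_corr s u v : inL2 u -> inL2 v ->
  measurable_fun [set: X] (fun w => gamh s * corr u v ((s / enorm w) *: w)).
Proof.
move=> su sv; apply: measurable_funM => //.
apply: (measurableT_comp (measurable_corr su.1 sv.1)).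
apply: measurable_rVZ => //; apply: measurable_funM => //.
(* The inverse is discontinuous at 0; its measurability on norms is that of the power with exponent
   -1. *)
under eq_fun do rewrite -powR_inv1 ?enorm_ge0//.
exact: (measurableT_comp (measurable_powR (-1)) (@measurable_enorm R n)).
Qed.

Lemma sphere_mean_bound s u v : inL2 u -> inL2 v -> dmin <= s <= dmax ->
  `|sphere_mean s u v| <= Gam * (4 * (L2n u * L2n v)) * om.
Proof.
move=> su sv sd.
apply: (proj2 (indicM_integrable (measurable_eball 1) (leb_eball_lty 1) _ _)).
  exact: measurable_radial_corr.
by move=> y _; rewrite normrM ler_pM// ?gamh_bound// corr_bound.
Qed.

Section regular.
Variables (u v : X -> R) (M : R).
Hypotheses (su : inL2 u) (sv : inL2 v) (M_ge0 : 0 <= M).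
Hypothesis uM : forall w, L2n (u \- tr w u) <= M * enorm w.

(** The Lipschitz constant of gamh(|y|) c(y) given by the product rule: [corr_bound] times [Kl],
    plus [Gam] times the constant of [corr_lip]. *)
Let P := (4 * Kl * L2n u + 2 * Gam * M) * L2n v.

(** The radii [a] and [b] are not tied to the norms of [y] and [z]: at w = 0 the radial projection
    is 0, while [gamh] is still evaluated at the radius of the sphere. *)
Lemma radial_corr_lip a b (y z : X) (e : R) :
  dmin <= a <= dmax -> dmin <= b <= dmax -> `|a - b| <= e ->
  enorm (y - z) <= e ->
  `|gamh a * corr u v y - gamh b * corr u v z| <= P * e.
Proof.
move=> ad bd abe yze.
have -> : gamh a * corr u v y - gamh b * corr u v z =
  (gamh a - gamh b) * corr u v y + gamh b * (corr u v y - corr u v z) by ring.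
have -> : P * e = (Kl * e) * (4 * (L2n u * L2n v)) + Gam * (2 * (M * e * L2n v)).
  by rewrite /P; ring.
rewrite (le_trans (ler_normD _ _))// !normrM; apply: lerD.
  rewrite ler_pM// ?corr_bound// (le_trans (gamh_lip ad bd))//.
  by rewrite ler_wpM2l.
rewrite ler_pM// ?gamh_bound//.
rewrite (le_trans (corr_lip su sv uM (enormBC _ _)))// ler_wpM2l//.
by rewrite ler_wpM2r ?nrm_ge0// ler_wpM2l.
Qed.

Lemma sphere_mean_lip s t : dmin <= s <= dmax -> dmin <= t <= dmax ->
  `|sphere_mean s u v - sphere_mean t u v| <= P * `|s - t| * om.
Proof.
move=> sd td.
have b r : dmin <= r <= dmax -> forall w, eball 1 w ->
    `|gamh r * corr u v ((r / enorm w) *: w)| <= Gam * (4 * (L2n u * L2n v)).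
  by move=> rd w _; rewrite normrM ler_pM// ?gamh_bound// corr_bound.
have mr r := measurable_radial_corr r su sv.
have I r (rd : dmin <= r <= dmax) := proj1 (indicM_integrable (measurable_eball 1)
  (leb_eball_lty 1) (mr r) (b r rd)).
rewrite /sphere_mean -RintegralB//; [|exact: I|exact: I].
under eq_Rintegral do rewrite -mulrBr.
apply: (proj2 (indicM_integrable (measurable_eball 1) (leb_eball_lty 1) _ _)).
  exact: measurable_funB.
move=> w _; apply: radial_corr_lip => //.
rewrite -scalerBl -mulrBl enormZ normrM -mulrA ler_piMr//.
have [->|w0] := eqVneq (enorm w) 0; first by rewrite mulr0 ler01.
by rewrite normrV ?unitfE// ger0_norm ?enorm_ge0// mulVf.
Qed.

(** [polar_shell] applied to the value at the radial projection to the sphere of radius [s]; points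
    of the shell move by at most [t - s]. *)
Lemma shell_form_polar s t : dmin <= s -> s <= t -> t <= dmax ->
  `|shell_form s t u v - (t ^+ n - s ^+ n) * sphere_mean s u v| <=
  P * (t - s) * ((t ^+ n - s ^+ n) * om).
Proof.
move=> sd st td; have s0 := lt_le_trans dmin_gt0 sd.
have sd' : dmin <= s <= dmax by rewrite sd (le_trans st).
rewrite shell_formE; apply: (@polar_shell _ _ _ _ (Gam * (4 * (L2n u * L2n v)))) => //.
- by apply: measurable_funM => //; exact: measurable_corr su.1 sv.1.
- exact: measurable_radial_corr.
- by move=> w; rewrite normrM ler_pM// ?gamh_bound// corr_bound.
- move=> r x r0; congr (_ * corr _ _ _); rewrite enormZ gtr0_norm// scalerA.
  have [x0|x0] := eqVneq (enorm x) 0.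
    have -> : x = 0.
      apply/rowP => i; apply/eqP; rewrite mxE -normr_le0 -x0.
      exact: coord_le_enorm.
    by rewrite !scaler0.
  congr (_ *: _); field; by rewrite x0 gt_eqF.
- move=> y /andP[sy yt]; have y0 := lt_trans s0 sy.
  apply: radial_corr_lip => //.
  + by rewrite (le_trans sd (ltW sy)) (le_trans yt).
  + by rewrite ger0_norm ?lerD2r// subr_ge0 ltW.
  (* The distance from [y] to its projection is |y| - s. *)
  + rewrite -{1}[y]scale1r -scalerBl enormZ ger0_norm.
      by rewrite mulrBl mul1r divfK ?gt_eqF// lerD2r.
    by rewrite subr_ge0 ler_pdivrMr// mul1r ltW.
Qed.

End regular.

Lemma shell_form_lip : exists2 C : R, 0 <= C & forall u v s t, inL2 u -> inL2 v ->
  dmin <= s -> s <= t -> t <= dmax ->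
  `|shell_form s t u v| <= C * (t - s) * (L2n u * L2n v).
Proof.
have D0 : 0 <= dmax by rewrite (le_trans (ltW dmin_gt0)).
have [c c0 Hc] := xslope_lip n D0.
exists (Gam * 4 * (c * om)); first by rewrite !mulr_ge0// omega_ge0.
move=> u v s t su sv sd st td.
rewrite (le_trans (shell_form_bound su sv sd st td))// xslopeE.
have s0 : 0 <= s by rewrite (le_trans (ltW dmin_gt0)).
have sD : 0 <= s <= dmax by rewrite s0 (le_trans st).
have tD : 0 <= t <= dmax by rewrite td (le_trans s0).
have [/andP[_ xc] _] := Hc s t s t sD tD sD tD.
have := omega_ge0 (R := R) (n := n); have := nrm_ge0 (leb n) u.
have := nrm_ge0 (leb n) v; move: (L2n u) (L2n v) om => a b o b0 a0 o0.
have -> : Gam * 4 * (c * o) * (t - s) * (a * b) =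
  Gam * (4 * (a * b)) * ((t - s) * c * o) by ring.
rewrite ler_wpM2l ?mulr_ge0// ler_wpM2r// ler_wpM2l// subr_ge0//.
Qed.

(** Up to O(t - s) the quotient equals [xslope n s t * sphere_mean s u v], a product of bounded
    Lipschitz functions of the end points. The terms t - s and t' - s' in the bound are the two
    replacement errors. *)
Lemma shell_form_slope_lip : exists2 C : R, 0 <= C &
  forall u v (M : R) s t s' t', inL2 u -> inL2 v -> 0 <= M ->
  (forall w, L2n (u \- tr w u) <= M * enorm w) ->
  dmin <= s -> s < t -> t <= dmax -> dmin <= s' -> s' < t' -> t' <= dmax ->
  `|shell_form s t u v / (t - s) - shell_form s' t' u v / (t' - s')| <=
  C * ((t - s) + (t' - s') + `|s - s'| + `|t - t'|) * ((L2n u + M) * L2n v).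
Proof.
have D0 : 0 <= dmax by rewrite (le_trans (ltW dmin_gt0)).
have [c c0 Hc] := xslope_lip n D0.
have o0 := omega_ge0 (R := R) (n := n).
exists (4 * (Gam + Kl) * (c * om)); first by rewrite !mulr_ge0// addr_ge0.
move=> u v M s t s' t' su sv M0 uM sd st td s'd st' t'd.
have H s1 t1 : dmin <= s1 -> s1 < t1 -> t1 <= dmax ->
  [/\ 0 <= s1 <= dmax, 0 <= t1 <= dmax, dmin <= s1 <= dmax &
    `|shell_form s1 t1 u v / (t1 - s1) - xslope n s1 t1 * sphere_mean s1 u v| <=
    (4 * Kl * L2n u + 2 * Gam * M) * L2n v * (t1 - s1) * (c * om)].
  move=> sd1 st1 td1.
  have s0 : 0 <= s1 by rewrite (le_trans (ltW dmin_gt0)).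
  have sD : 0 <= s1 <= dmax by rewrite s0 (le_trans (ltW st1)).
  have tD : 0 <= t1 <= dmax by rewrite td1 (le_trans s0 (ltW st1)).
  split => //; first by rewrite sd1 (le_trans (ltW st1)).
  have [/andP[x0 xc] _] := Hc s1 t1 s1 t1 sD tD sD tD.
  have := shell_form_polar su sv M0 uM sd1 (ltW st1) td1.
  rewrite xslopeE; have ts0 : 0 < t1 - s1 by rewrite subr_gt0.
  set F := shell_form _ _ _ _; set q := sphere_mean _ _ _ => h.
  have -> : F / (t1 - s1) - xslope n s1 t1 * q =
    (F - (t1 - s1) * xslope n s1 t1 * q) / (t1 - s1) by field; rewrite gt_eqF.
  rewrite normrM normfV [X in _ / X]gtr0_norm// ler_pdivrMr//.
  apply: (le_trans h); rewrite -[leRHS]mulrA ler_wpM2l//.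
    rewrite !mulr_ge0 ?(ltW ts0) ?nrm_ge0// addr_ge0// !mulr_ge0// ?nrm_ge0//.
  by rewrite -mulrA mulrC ler_wpM2r ?(ltW ts0)// ler_wpM2r.
have [sD tD sd2 h1] := H _ _ sd st td.
have [s'D t'D s'd2 h2] := H _ _ s'd st' t'd.
have [/andP[x0 xc] hx] := Hc s t s' t' sD tD s'D t'D.
have [/andP[x0' xc'] _] := Hc s' t' s t s'D t'D sD tD.
have hq := sphere_mean_bound su sv sd2.
have hl := sphere_mean_lip su sv M0 uM sd2 s'd2.
have hxq : `|xslope n s t * sphere_mean s u v - xslope n s' t' * sphere_mean s' u v|
  <= c * (`|s - s'| + `|t - t'|) * (Gam * (4 * (L2n u * L2n v)) * om) +
     c * ((4 * Kl * L2n u + 2 * Gam * M) * L2n v * `|s - s'| * om).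
  move: (xslope n s t) (xslope n s' t') (sphere_mean s u v)
    (sphere_mean s' u v) x0' xc' hx hq hl => x x' q q' x0' xc' hx hq hl.
  have -> : x * q - x' * q' = (x - x') * q + x' * (q - q') by ring.
  by rewrite (le_trans (ler_normD _ _))// !normrM (ger0_norm x0') lerD// ler_pM.
set A := shell_form s t u v / (t - s) in h1 *.
set B := shell_form s' t' u v / (t' - s') in h2 *.
move: (xslope n s t * sphere_mean s u v)
  (xslope n s' t' * sphere_mean s' u v) h1 h2 hxq => a b h1 h2 hxq.
have /le_trans : `|A - B| <= `|A - a| + `|B - b| + `|a - b|.
  have -> : A - B = (A - a) + (b - B) + (a - b) by ring.
  rewrite (le_trans (ler_normD _ _))// lerD2r (le_trans (ler_normD _ _))// lerD2l.
  by rewrite distrC.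
apply; apply: (le_trans (lerD (lerD h1 h2) hxq)).
by apply: slope_bound_algebra => //; rewrite ?nrm_ge0 ?subr_ge0 ?ltW.
Qed.

End shell_form.

(** * Test functions *)

Section open_measurable.
Context {R : realType} {n : nat}.
Local Notation X := 'rV[R]_n.

Definition rat_cube (q : 'rV[rat]_n * rat) : set X :=
  [set x | forall i, `|x ord0 i - ratr (q.1 ord0 i)| < ratr q.2].

Lemma measurable_rat_cube q : measurable (rat_cube q).
Proof.
rewrite (_ : rat_cube q = \bigcap_(i in [set: 'I_n]) (@rV_coord R n i @^-1`
    `](ratr (q.1 ord0 i) - ratr q.2), (ratr (q.1 ord0 i) + ratr q.2)[)).
  apply: fin_bigcap_measurable => // i _.
  by rewrite -[X in measurable X]setTI; exact: measurable_rV_coord.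
apply/seteqP; split => x /= h i; first
  by move=> _; rewrite /= in_itv/= -ltr_distl; exact: h.
by have := h i Logic.I; rewrite /= in_itv/= -ltr_distl.
Qed.

(** The sigma-algebra is generated by the coordinates, so [U] is written as the countable union of
    the rational cubes that it contains. *)
Lemma open_rV_measurable (U : set X) : open U -> measurable U.
Proof.
move=> oU.
rewrite (_ : U = \bigcup_q (if `[< rat_cube q `<=` U >] then rat_cube q else set0)).
  apply: countable_bigcupT_measurable.
    exact: countableP.
  by move=> q; case: ifP => _ //; exact: measurable_rat_cube.
apply/seteqP; split => [x Ux|x [q _]]; last by case: asboolP => // h /h.
have /nbhs_ballP[e /= e0 xeU] : nbhs x U by apply: open_nbhs_nbhs.
(* Both [x] and any point of the cube are within r of its rational centre in each coordinate, so 2 r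
   < e keeps the cube inside [U]. The lower bound only makes r positive. *)
have [r re] : exists r : rat, ratr r \in `](e / 4), (e / 2)[.
  by apply: rat_in_itvoo; lra.
rewrite in_itv/= in re; case/andP: re => r1 r2.
have r0 : 0 < ratr r :> R by lra.
have H i : exists p : rat, `|x ord0 i - ratr p| < ratr r.
  have [p] : exists p : rat, ratr p \in `](x ord0 i - ratr r), (x ord0 i + ratr r)[.
    by apply: rat_in_itvoo; lra.
  rewrite in_itv/= => h; exists p.
  by rewrite distrC ltr_distl.
have [p Hp] := choice H.
exists (\row_i p i, r) => //; case: asboolP => [_|[]].
  by move=> i /=; rewrite mxE.
move=> y /= hy; apply: xeU; split => // i j; rewrite (ord1 i).
rewrite /ball/=; have := hy j; rewrite mxE.
have := Hp j; rewrite !ltr_norml => /andP[a1 a2] /andP[a3 a4].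
by apply/andP; split; lra.
Qed.

Lemma continuous_rV_measurable (f : X -> R) : continuous f ->
  measurable_fun [set: X] f.
Proof.
move=> cf; apply: (measurability _ (RGenOpens.measurableE R)) => _ [_ [a [b ->] <-]].
rewrite setTI; apply: open_rV_measurable.
apply: open_comp; last exact: interval_open.
by move=> x _; exact: cf.
Qed.

End open_measurable.

(** * Test functions and their difference quotients *)

Section test_functions.
Context {R : realType} {n : nat}.
Local Notation X := 'rV[R]_n.
Variable Omega : set X.
Implicit Types (phi psi : X -> R) (i : 'I_n).
Local Notation L2n := (nrm (@leb R n)).
Local Notation inL2 := (sqint (@leb R n)).
Local Notation e_ := (@basis_vec R n).

Definition quot i (h : R) phi : X -> R := fun x => h^-1 * (phi (x + h *: e_ i) - phi x).

Lemma test_fun_cube phi : test_fun Omega phi ->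
  exists2 r : R, 0 <= r & forall x, ~ cube r x -> phi x = 0.
Proof.
move=> [_ [K [cK _ phi0]]].
have /compact_bounded[M [_ KM]] := cK.
exists (`|M| + 1); first by rewrite addr_ge0.
move=> x xM; apply: phi0 => Kx; apply: xM => i.
have := KM (`|M| + 1); rewrite ltr_pwDr ?ler_norm// => /(_ isT x Kx).
apply: le_trans; rewrite /Num.norm/= mx_normE.
rewrite [X in X <= _](_ : _ = (`|x ord0 i|%:nng)%:num)//.
rewrite [_ <= _%:num]num_le.
exact: (@le_bigmax _ _ _ _ (fun ij : 'I_1 * 'I_n => `|x ij.1 ij.2|%:nng) (ord0, i)).
Qed.

Lemma test_fun_continuous phi : test_fun Omega phi -> continuous phi.
Proof. by move=> [/(_ 0%N)]. Qed.

Lemma test_fun_derivable phi i x : test_fun Omega phi -> derivable phi x (e_ i).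
Proof. by move=> [/(_ 1%N)[_ /(_ i)[]]]. Qed.

Lemma test_fun_measurable phi : test_fun Omega phi -> measurable_fun [set: X] phi.
Proof. by move=> /test_fun_continuous; exact: continuous_rV_measurable. Qed.

Lemma test_fun_out phi x : test_fun Omega phi -> ~ Omega x -> phi x = 0.
Proof. by move=> [_ [K [_ KO phi0]]] xO; apply: phi0 => /KO. Qed.

(** The same compact set works: its complement is open, so [phi] vanishes near each point outside
    it. [H10_tr] relies on this when it tests with a derivative of a test function. *)
Lemma test_fun_partial phi i : test_fun Omega phi -> test_fun Omega (partial i phi).
Proof.
move=> [Cphi [K [cK KO phi0]]]; split.
  by move=> k; have [_ /(_ i)[_]] := Cphi k.+1.
exists K; split => // x Kx.
have oK : open (~` K).
  by rewrite openC; apply: compact_closed => //; exact: norm_hausdorff.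
have nK : nbhs x (~` K) by apply: open_nbhs_nbhs.
apply/cvg_lim => //; apply: cvg_near_cst.
have : \forall h \near (0:R)^', (~` K) (h *: e_ i + x).
  apply: nbhs_dnbhs.
  have /= c : (fun h : R => h *: e_ i + x) @ 0 --> 0 *: e_ i + x.
    apply: cvgD; last exact: cvg_cst.
    by apply: cvgZr_tmp; exact: cvg_id.
  by rewrite scale0r add0r in c; exact: c _ nK.
apply: filterS => h /= hK.
by rewrite (phi0 _ hK) (phi0 _ Kx) subrr scaler0.
Qed.

Lemma test_fun_bounded phi : test_fun Omega phi ->
  exists2 C : R, 0 <= C & forall x, `|phi x| <= C.
Proof.
move=> tphi; have cphi := test_fun_continuous tphi.
have [_ [K [cK _ phi0]]] := tphi.
have /compact_bounded[M [_ KM]] : compact (phi @` K).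
  apply: continuous_compact => //; exact: continuous_subspaceT.
exists (`|M| + 1); first by rewrite addr_ge0.
move=> x; have [Kx|Kx] := pselect (K x); last first.
  by rewrite (phi0 _ Kx) normr0 addr_ge0.
by apply: KM; [rewrite ltr_pwDr ?ler_norm|exists x].
Qed.

Lemma cube_sqint (f : X -> R) r C : measurable_fun [set: X] f ->
  (forall x, `|f x| <= C) -> (forall x, ~ cube r x -> f x = 0) -> inL2 f.
Proof.
move=> mf fC f0; split => //.
apply: (proj1 (@bounded_integral _ _ _ (leb n) (cube r) (fun x => f x ^+ 2)
  (C ^+ 2) _ _ _ _)).
- exact: measurable_cube.
- exact: leb_cube_lty.
- exact: measurable_funX.
- move=> x; rewrite indicE; have [|] := boolP (x \in cube r).
    by rewrite inE mulr1 normrX lerXn2r ?nnegrE// (le_trans _ (fC x)).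
  by move/negP; rewrite inE => /f0 ->; rewrite expr0n normr0 mulr0.
Qed.

Lemma test_fun_sqint phi : test_fun Omega phi -> inL2 phi.
Proof.
move=> tphi; have [C _ phiC] := test_fun_bounded tphi.
have [r _ phi0] := test_fun_cube tphi.
exact: cube_sqint (test_fun_measurable tphi) phiC phi0.
Qed.

Lemma test_fun_line phi i x (t : R) : test_fun Omega phi ->
  is_derive t 1 (fun s => phi (x + s *: e_ i)) (partial i phi (x + t *: e_ i)).
Proof.
move=> tphi.
have E : (fun h : R => h^-1 *: (((fun s : R => phi (x + s *: e_ i)) \o shift t) (h *: 1) -
    phi (x + t *: e_ i))) =
  (fun h : R => h^-1 *: ((phi \o shift (x + t *: e_ i)) (h *: e_ i) - phi (x + t *: e_ i))).
  apply/funext => h /=; congr (_ *: (phi _ - _)).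
  by rewrite /shift/= -[h *: 1]/(h * 1) mulr1 scalerDl addrCA.
have d : derivable phi (x + t *: e_ i) (e_ i) by exact: test_fun_derivable.
apply: DeriveDef; first by rewrite /derivable E.
by rewrite /derive E.
Qed.

(** The mean value theorem on the line through [x]. Uniformity in [h] and [x] is what dominated
    convergence asks for; at h = 0 the quotient is 0 because the inverse of 0 is 0. *)
Lemma quot_bound phi i : test_fun Omega phi ->
  exists2 C : R, 0 <= C & forall h x, `|quot i h phi x| <= C.
Proof.
move=> tphi; have [C C0 dC] := test_fun_bounded (test_fun_partial i tphi).
exists C => // h x; have [->|h0] := eqVneq h 0.
  by rewrite /quot invr0 mul0r normr0.
pose g s := phi (x + s *: e_ i).
have dg (t : R) : is_derive t (1 : R) g (partial i phi (x + t *: e_ i)).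
  exact: test_fun_line.
have cg (a b : R) : {within `[a, b], continuous g}.
  by apply: derivable_within_continuous => t _; have [] := dg t.
have -> : quot i h phi x = h^-1 * (g h - g 0) by rewrite /quot /g scale0r addr0.
have [h_gt0|h_lt0|/eqP] := ltgtP 0 h; last by rewrite eq_sym (negbTE h0).
  have [c _ ->] := MVT h_gt0 (fun t _ => dg t) (cg 0 h).
  by rewrite subr0 mulrC mulfK.
have [c _ E] := MVT h_lt0 (fun t _ => dg t) (cg h 0).
by rewrite -opprB E sub0r !mulrN opprK mulrC mulfK.
Qed.

Lemma quot_out phi i r (H h : R) x : (forall x, ~ cube r x -> phi x = 0) ->
  `|h| <= H -> ~ cube (r + H) x -> quot i h phi x = 0.
Proof.
move=> phi0 hH xr; rewrite /quot !phi0 ?subrr ?mulr0// => xr'; apply: xr => j.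
  by rewrite (le_trans (xr' j))// lerDl (le_trans _ hH).
have := xr' j; rewrite !mxE => xj.
have -> : x ord0 j = (x ord0 j + h * (j == i)%:R) - h * (j == i)%:R by rewrite addrK.
rewrite (le_trans (ler_normB _ _))// lerD// normrM (le_trans _ hH)//.
by rewrite ler_piMr// normr_nat; case: (_ == _).
Qed.

Lemma quot_measurable phi i h : test_fun Omega phi ->
  measurable_fun [set: X] (quot i h phi).
Proof.
move=> tphi; have mp := test_fun_measurable tphi.
apply: measurable_funM => //; apply: measurable_funB => //.
exact: (measurableT_comp mp (measurable_translation _)).
Qed.

Lemma quot_cvg phi i x (h : R^nat) : test_fun Omega phi ->
  (forall k, h k != 0) -> h @ \oo --> (0 : R) ->
  (fun k => quot i (h k) phi x) @ \oo --> partial i phi x.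
Proof.
move=> tphi h0 hc.
have d : derivable phi x (e_ i) by exact: test_fun_derivable.
have := (cvgr_dnbhsP (fun h : R => h^-1 *: ((phi \o shift x) (h *: e_ i) - phi x))
  0 (partial i phi x)).1 d h (conj h0 hc).
apply: cvg_trans; apply: near_eq_cvg; near=> k.
by rewrite /quot [x + _]addrC.
Unshelve. all: by end_near. Qed.

Lemma cube_dct (f_ : (X -> R)^nat) (f : X -> R) r C :
  (forall k, measurable_fun [set: X] (f_ k)) -> measurable_fun [set: X] f ->
  (forall k x, `|f_ k x| <= C) -> (forall k x, ~ cube r x -> f_ k x = 0) ->
  (forall x, (fun k => f_ k x) @ \oo --> f x) ->
  (fun k => \int[leb n]_x f_ k x) @ \oo --> \int[leb n]_x f x.
Proof.
move=> mf_ mf fC f0 ff.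
have iA : (leb n).-integrable [set: X] (EFin \o (fun x : X => C * \1_(cube r) x)).
  exact: (integrableZl measurableT C (integrable_indic_fin (measurable_cube r)
    (leb_cube_lty r))).
have [||||i1 _ c] := @dominated_convergence _ _ _ (leb n) setT measurableT
   (fun k x => (f_ k x)%:E) (EFin \o f) _ _ _ _ iA.
- by move=> k; exact/measurable_EFinP.
- exact/measurable_EFinP.
- by apply: aeW => x _; apply: cvg_EFin; [exact: nearW|exact: ff].
- apply: aeW => x k _ /=; rewrite lee_fin indicE.
  have [_|/negP] := boolP (x \in cube r); first by rewrite mulr1.
  by rewrite inE => /f0 ->; rewrite normr0 mulr0.
apply: fine_cvg => /=.
by rewrite fineK//; exact: (integrable_fin_num measurableT i1).
Qed.

End test_functions.

(** * Integration by parts and translation of test functions *)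

Section test_function_translation.
Context {R : realType} {n : nat}.
Local Notation X := 'rV[R]_n.
Variable Omega : set X.
Implicit Types (phi psi : X -> R) (i : 'I_n).
Local Notation L2n := (nrm (@leb R n)).
Local Notation inL2 := (sqint (@leb R n)).
Local Notation ipn := (ip (@leb R n)).
Local Notation e_ := (@basis_vec R n).

Lemma ip_trl y phi psi : inL2 phi -> inL2 psi ->
  ipn (tr y phi) psi = ipn phi (tr (- y) psi).
Proof.
move=> sp sq; rewrite -(ip_tr (- y) (tr_sqint y sp) sq); congr (ip _ _ _).
by apply/funext => x; rewrite /tr subrK.
Qed.

Lemma quotE i h phi : quot i h phi = fun x => h^-1 * (tr (h *: e_ i) phi \- phi) x.
Proof. by []. Qed.

(** Discrete integration by parts, from the translation invariance of the measure. *)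
Lemma quot_adjoint i h phi psi : inL2 phi -> inL2 psi ->
  ipn (quot i h phi) psi = - ipn phi (quot i (- h) psi).
Proof.
move=> sp sq; have sp' := tr_sqint (h *: e_ i) sp.
have sq' := tr_sqint (- (h *: e_ i)) sq.
rewrite !quotE ipZl//; last exact: sqintB.
rewrite [ipn phi _]ipC ipZl//; last by apply: sqintB => //; exact: tr_sqint.
rewrite scaleNr !ipBl// ip_trl// (ipC _ (tr _ psi) phi) (ipC _ psi phi).
by rewrite invrN mulNr opprK.
Qed.

Lemma quot_ip_cvg i phi psi (h : R^nat) : test_fun Omega phi -> test_fun Omega psi ->
  (forall k, h k != 0) -> h @ \oo --> (0 : R) ->
  (fun k => ipn (quot i (h k) phi) psi) @ \oo --> ipn (partial i phi) psi.
Proof.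
move=> tp tq h0 hc.
have [C C0 pC] := quot_bound i tp; have [D D0 qD] := test_fun_bounded tq.
have [r r0 qr] := test_fun_cube tq.
apply: (@cube_dct _ _ _ _ r (C * D)).
- move=> k; apply: measurable_funM; last exact: test_fun_measurable tq.
  exact: quot_measurable tp.
- apply: measurable_funM; last exact: test_fun_measurable tq.
  exact: test_fun_measurable (test_fun_partial i tp).
- by move=> k x; rewrite normrM ler_pM.
- by move=> k x /qr ->; rewrite mulr0.
- by move=> x; apply: cvgM; [exact: quot_cvg tp h0 hc|exact: cvg_cst].
Qed.

(** The limit of [quot_adjoint] along h = 1/(k + 1): the quotients with steps h and - h both
    converge to partial derivatives. *)
Lemma test_fun_ibp i phi psi : test_fun Omega phi -> test_fun Omega psi ->
  ipn (partial i phi) psi = - ipn phi (partial i psi).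
Proof.
move=> tp tq; pose h (k : nat) : R := k.+1%:R^-1.
have h0 k : h k != 0 by rewrite invr_eq0 pnatr_eq0.
have hc : h @ \oo --> (0 : R) by exact: cvg_harmonic.
have c1 := quot_ip_cvg (i := i) tp tq h0 hc.
have hN0 k : - h k != 0 by rewrite oppr_eq0.
have hNc : (fun k => - h k) @ \oo --> (0 : R) by rewrite -oppr0; exact: cvgN.
have c2 := cvgN (quot_ip_cvg (i := i) tq tp hN0 hNc).
have E : (fun k => ipn (quot i (h k) phi) psi) =
    (fun k => - ipn (quot i (- h k) psi) phi).
  apply/funext => k.
  rewrite quot_adjoint; [|exact: test_fun_sqint tp|exact: test_fun_sqint tq].
  by rewrite ipC.
rewrite E in c1; rewrite (ipC _ phi).
rewrite -(cvg_lim _ c1)//.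
exact: (cvg_lim _ (c2 _)).
Qed.

(** The triangle inequality over [k] equal steps, each of the same cost by translation
    invariance. *)
Lemma nrm_tr_natmul phi y k : inL2 phi ->
  L2n (phi \- tr (k%:R *: y) phi) <= k%:R * L2n (phi \- tr y phi).
Proof.
move=> sp; elim: k => [|k IH].
  rewrite mul0r scale0r (_ : _ \- _ = cst 0).
    rewrite /nrm /ip; under eq_Rintegral do rewrite mul0r.
    by rewrite /Rintegral integral0 sqrtr0.
  by apply/funext => x; rewrite /tr /= addr0 subrr.
have s1 := tr_sqint (k%:R *: y) sp; have s2 := tr_sqint (k.+1%:R *: y) sp.
apply: (le_trans (nrmB3 sp s1 s2)).
rewrite nrm_tr2// -scalerBl -natrB// subSnn scale1r.
rewrite -[leRHS]/(_ * L2n (phi \- tr y phi)) mulrSr mulrDl mul1r.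
by rewrite lerD2r.
Qed.

(* Subadditivity in [s] reduces the estimate to infinitesimal translations. *)
Lemma test_fun_tr i phi (s : R) : test_fun Omega phi ->
  L2n (phi \- tr (s *: e_ i) phi) <= `|s| * L2n (partial i phi).
Proof.
move=> tp; have sp := test_fun_sqint tp; have tdp := test_fun_partial i tp.
have sdp := test_fun_sqint tdp.
have [->|s0] := eqVneq s 0.
  by have := nrm_tr_natmul (s *: e_ i) 0 sp; rewrite !scale0r normr0 !mul0r.
pose h (k : nat) : R := s / k.+1%:R.
have h0 k : h k != 0 by rewrite mulf_neq0// invr_eq0 pnatr_eq0.
have hc : h @ \oo --> (0 : R).
  rewrite -(mulr0 s); apply: cvgM; first exact: cvg_cst.
  exact: cvg_harmonic.
have le k : L2n (phi \- tr (s *: e_ i) phi) ^+ 2 <=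
    s ^+ 2 * ipn (quot i (h k) phi) (quot i (h k) phi).
  rewrite -nrm_sqr -(real_normK (num_real s)) -exprMn.
  rewrite lerXn2r ?nnegrE ?mulr_ge0 ?nrm_ge0//.
  have := nrm_tr_natmul (h k *: e_ i) k.+1 sp.
  rewrite scalerA mulrC /h divfK ?pnatr_eq0// -/(h k) => /le_trans; apply.
  rewrite quotE nrmZ; last by apply: sqintB => //; exact: tr_sqint.
  rewrite nrmBC mulrA le_eqVlt; apply/orP; left; apply/eqP; congr (_ * _).
  rewrite /h invf_div normrM normfV mulrCA mulfV ?normr_eq0// mulr1.
  by rewrite ger0_norm.
rewrite -ler_sqr ?nnegrE ?mulr_ge0 ?nrm_ge0// exprMn.
rewrite real_normK ?num_real// [in leRHS]nrm_sqr.
have [C C0 pC] := quot_bound i tp; have [r r0 pr] := test_fun_cube tp.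
have hs k : `|h k| <= `|s|.
  rewrite normrM ler_piMr// normfV ger0_norm// invf_le1 ?ltr0n//.
  by rewrite ler1n.
have c : (fun k => ipn (quot i (h k) phi) (quot i (h k) phi)) @ \oo -->
    ipn (partial i phi) (partial i phi).
  apply: (@cube_dct _ _ _ _ (r + `|s|) (C * C)).
  - by move=> k; apply: measurable_funM; exact: quot_measurable tp.
  - by apply: measurable_funM; exact: test_fun_measurable tdp.
  - by move=> k x; rewrite normrM ler_pM.
  - by move=> k x xr; rewrite (quot_out i pr (hs k) xr) mulr0.
  - by move=> x; apply: cvgM; exact: quot_cvg tp h0 hc.
have c' := cvgM (cvg_cst (s ^+ 2)) c.
rewrite -(cvg_lim _ (c' _ _))//; apply: limr_ge.
  by apply/cvg_ex; eexists; exact: (c' _ _).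
by apply: nearW => k; exact: le.
Qed.

(** Translate along one coordinate axis after another. Bounding each |w_i| by [enorm w] produces the
    factor [n]. *)
Lemma test_fun_tr_le phi (M : R) (w : X) : test_fun Omega phi ->
  (forall i, L2n (partial i phi) <= M) ->
  L2n (phi \- tr w phi) <= n%:R * M * enorm w.
Proof.
move=> tp dM; have sp := test_fun_sqint tp.
have H : L2n (phi \- tr (\sum_i w ord0 i *: e_ i) phi) <=
    \sum_(i < n) `|w ord0 i| * L2n (partial i phi).
  apply: (big_ind2 (fun (y : X) (b : R) => L2n (phi \- tr y phi) <= b)).
  - by have := nrm_tr_natmul 0 0 sp; rewrite scaler0 mul0r.
  - move=> y b z c yb zc; have sy := tr_sqint y sp; have syz := tr_sqint (y + z) sp.
    apply: (le_trans (nrmB3 sp sy syz)); rewrite nrm_tr2// addrAC subrr add0r.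
    exact: lerD.
  - by move=> i _; exact: test_fun_tr.
rewrite (_ : \sum_i _ = w) in H; last first.
  by rewrite [RHS]row_sum_delta.
apply: (le_trans H).
apply: (@le_trans _ _ (\sum_(i < n) enorm w * M)).
  apply: ler_sum => i _; apply: ler_pM => //; first exact: nrm_ge0.
  exact: coord_le_enorm.
by rewrite sumr_const card_ord -[_ * M *+ n]mulr_natl -mulrA (mulrC M).
Qed.

End test_function_translation.

(** * Translation estimate in H^1_0 *)

Section sobolev_translation.
Context {R : realType} {n : nat}.
Local Notation X := 'rV[R]_n.
Variable Omega : set X.
Implicit Types (phi psi v : X -> R) (i : 'I_n).
Local Notation L2n := (nrm (@leb R n)).
Local Notation inL2 := (sqint (@leb R n)).
Local Notation ipn := (ip (@leb R n)).

Lemma L2P v : L2 Omega v <-> inL2 (v \_ Omega).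
Proof. exact: Lfun_sqint. Qed.

Lemma L2normE v : L2 Omega v -> L2norm Omega v = (L2n (v \_ Omega))%:E.
Proof. by move=> /L2P sv; rewrite /L2norm Lnorm_nrm. Qed.

Lemma test_fun_restrict phi : test_fun Omega phi -> phi \_ Omega = phi.
Proof.
move=> tp; apply/funext => x; rewrite patchE; case: ifPn => // /negP.
by rewrite inE => xO; rewrite (test_fun_out tp xO).
Qed.

Lemma restrictB v phi : (v \- phi) \_ Omega = v \_ Omega \- phi \_ Omega.
Proof. by apply/funext => x; rewrite /= !patchE; case: ifP => // _; rewrite subrr. Qed.

Lemma integral_test_fun v psi : L2 Omega v -> test_fun Omega psi ->
  (\int[leb n]_(x in Omega) (v x * psi x)%:E)%E = (ipn (v \_ Omega) psi)%:E.
Proof.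
move=> /L2P sv tp; rewrite ip_EFin//; last exact: test_fun_sqint tp.
rewrite [LHS]integral_mkcond; apply: eq_integral => x _.
by rewrite !patchE; case: ifP => // _; rewrite mul0r.
Qed.

Lemma weak_gradP v (g : 'I_n -> X -> R) : L2 Omega v ->
  is_weak_grad Omega v g <-> forall i, L2 Omega (g i) /\
    forall psi, test_fun Omega psi ->
      ipn (v \_ Omega) (partial i psi) = - ipn (g i \_ Omega) psi.
Proof.
move=> Lv; split => H i; have [Lg Hg] := H i; split => // psi tp.
  have := Hg psi tp; rewrite !integral_test_fun//; last exact: test_fun_partial.
  by rewrite -EFinN => -[].
rewrite !integral_test_fun ?Hg//; exact: test_fun_partial.
Qed.

(** By [test_fun_ibp] the classical gradient of [phi] is a weak one. The existence of a weak
    gradient of [v \- phi] makes the choice in [weak_grad] meaningful for it. *)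
Lemma weak_grad_subtest v (g : 'I_n -> X -> R) phi : L2 Omega v ->
  test_fun Omega phi -> is_weak_grad Omega v g ->
  L2 Omega (v \- phi) /\
  is_weak_grad Omega (v \- phi) (fun i => g i \- partial i phi).
Proof.
move=> Lv tp /(weak_gradP _ Lv) wg.
have sv := (L2P v).1 Lv; have sp := test_fun_sqint tp.
have Lvp : L2 Omega (v \- phi).
  by apply/L2P; rewrite restrictB (test_fun_restrict tp); exact: sqintB.
split => //; apply/(weak_gradP _ Lvp) => i.
have [/L2P sg Hg] := wg i; have tdp := test_fun_partial i tp.
have sdp := test_fun_sqint tdp.
split; first by apply/L2P; rewrite restrictB (test_fun_restrict tdp); exact: sqintB.
move=> psi tpsi; have spsi := test_fun_sqint tpsi.
have sdpsi := test_fun_sqint (test_fun_partial i tpsi).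
rewrite !restrictB (test_fun_restrict tp) (test_fun_restrict tdp) !ipBl// Hg//.
by rewrite (test_fun_ibp i tp tpsi) opprK opprD.
Qed.

Lemma H1norm_ge v (M : R) : L2 Omega v -> (forall i, L2 Omega (weak_grad Omega v i)) ->
  (H1norm Omega v <= M%:E)%E ->
  L2n (v \_ Omega) <= M /\ forall i, L2n (weak_grad Omega v i \_ Omega) <= M.
Proof.
move=> Lv Lg; rewrite /H1norm L2normE//.
under eq_bigr do rewrite L2normE// poweR_EFin powR_mulrn ?nrm_ge0//.
rewrite poweR_EFin powR_mulrn ?nrm_ge0// sumEFin -EFinD poweR_EFin lee_fin.
have S0 : 0 <= \sum_(i < n) L2n (weak_grad Omega v i \_ Omega) ^+ 2.
  by apply: sumr_ge0 => i _; exact: sqr_ge0.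
rewrite powR12_sqrt ?addr_ge0 ?sqr_ge0// => le.
have M0 : 0 <= M by apply: le_trans le; exact: sqrtr_ge0.
have {}le : L2n (v \_ Omega) ^+ 2 + \sum_(i < n) L2n (weak_grad Omega v i \_ Omega) ^+ 2
    <= M ^+ 2.
  by rewrite -[leLHS]sqr_sqrtr ?addr_ge0 ?sqr_ge0// lerXn2r// nnegrE sqrtr_ge0.
split=> [|i]; rewrite -ler_sqr ?nnegrE ?nrm_ge0//; apply: le_trans le.
  by rewrite lerDl.
rewrite (bigD1 i)//= addrCA lerDl addr_ge0 ?sqr_ge0//.
by apply: sumr_ge0 => j _; exact: sqr_ge0.
Qed.

(* The bound on [partial i phi] comes from testing the weak gradients of [v]
   and [v - phi] against [partial i phi] itself. *)
Lemma H10_tr v (M : R) : measurable_fun [set: X] v ->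
  {ae leb n, forall x, ~ Omega x -> v x = 0} ->
  H10 Omega v -> (H1norm Omega v <= M%:E)%E ->
  [/\ inL2 v, L2n v <= M & forall w, L2n (v \- tr w v) <= n%:R * M * enorm w].
Proof.
move=> mv v0 [[Lv [g0 wg0]] Hv] vM.
have aev : {ae leb n, forall x, v x = (v \_ Omega) x}.
  apply: filterS v0 => x vx; rewrite patchE; case: ifPn => // /negP.
  by rewrite inE.
have sV := (L2P v).1 Lv.
have [sv nv] := ae_sqint aev mv sV.
have wg : is_weak_grad Omega v (weak_grad Omega v).
  by apply: (xgetPex (fun _ _ => 0)); exists g0.
have wgv := (weak_gradP (weak_grad Omega v) Lv).1 wg.
have [vM1 gM] := H1norm_ge Lv (fun i => (wg i).1) vM.
split => //; first by rewrite nv.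
move=> w; apply/ler_addgt0Pr => e e0.
(* The final error is [eps] for v - phi, [eps] for its translate, and [n%:R * eps * enorm w] from
   the gradient bound M + eps; together they make [e]. *)
pose eps := e / (2 + n%:R * enorm w).
have d0 : 0 < 2 + n%:R * enorm w by rewrite ltr_wpDr// mulr_ge0// enorm_ge0.
have eps0 : 0 < eps by rewrite divr_gt0.
have [phi tp Hphi] := Hv eps eps0.
have [Lvp wgp0] := weak_grad_subtest Lv tp wg.
have wgp : is_weak_grad Omega (v \- phi) (weak_grad Omega (v \- phi)).
  by apply: (xgetPex (fun _ _ => 0)); eexists; exact: wgp0.
have wgpv := (weak_gradP (weak_grad Omega (v \- phi)) Lvp).1 wgp.
have [vpe ge] := H1norm_ge Lvp (fun i => (wgp i).1) (ltW Hphi).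
rewrite restrictB (test_fun_restrict tp) in vpe.
have sp := test_fun_sqint tp.
have dphi i : L2n (partial i phi) <= M + eps.
  have tdp := test_fun_partial i tp; have sdp := test_fun_sqint tdp.
  have [/L2P sg Hg] := wgv i; have [/L2P sh Hh] := wgpv i.
  (* The two weak gradients are chosen independently, so their difference need not be
     [partial i phi] at every point; only the pairing with a test function is compared. *)
  have E : L2n (partial i phi) ^+ 2 =
      ipn (weak_grad Omega v i \_ Omega \- weak_grad Omega (v \- phi) i \_ Omega)
        (partial i phi).
    have := Hg _ tdp; have := Hh _ tdp.
    rewrite restrictB (test_fun_restrict tp).
    have sddp := test_fun_sqint (test_fun_partial i tdp).
    rewrite !ipBl// nrm_sqr (test_fun_ibp i tp tdp).
    move: (ipn (v \_ Omega) (partial i (partial i phi)))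
      (ipn phi (partial i (partial i phi)))
      (ipn (weak_grad Omega v i \_ Omega) (partial i phi))
      (ipn (weak_grad Omega (v \- phi) i \_ Omega) (partial i phi)).
    by move=> a b c d; lra.
  have [->|N0] := eqVneq (L2n (partial i phi)) 0.
    by rewrite addr_ge0 ?(ltW eps0)// (le_trans _ vM1)// nrm_ge0.
  have N1 : 0 < L2n (partial i phi) by rewrite lt_def N0 nrm_ge0.
  rewrite -(ler_pM2r N1) -expr2 E.
  apply: (le_trans (ler_norm _)).
  apply: (le_trans (cauchy_schwarz (sqintB sg sh) sdp)).
  rewrite ler_pM2r//; apply: (le_trans (nrmB sg sh)).
  by rewrite lerD.
have vphi : L2n (v \- phi) <= eps.
  rewrite (_ : L2n _ = L2n (v \_ Omega \- phi))//.
  apply: (proj2 (ae_sqint _ _ (sqintB sV sp))); last exact: (sqintB sv sp).1.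
  by apply: filterS aev => x /= ->.
have swv := tr_sqint w sv; have swp := tr_sqint w sp.
apply: (le_trans (nrmB3 sv sp swv)).
apply: (le_trans (lerD vphi (nrmB3 sp swp swv))).
have -> : L2n (tr w phi \- tr w v) = L2n (v \- phi).
  by rewrite nrmBC -(nrm_tr w (sqintB sv sp)).
have := test_fun_tr_le w tp dphi.
have -> : e = eps * (2 + n%:R * enorm w) by rewrite /eps divfK ?gt_eqF.
move: (L2n (v \- phi)) (L2n (phi \- tr w phi)) (enorm w) vphi.
by move=> a b y ae ble; rewrite mulrDr; nra.
Qed.

End sobolev_translation.

(** * The energy and its difference quotients *)

Section energy.
Context {R : realType} {n : nat}.
Local Notation X := 'rV[R]_n.
Variables (Omega : set X) (gam : X -> X -> R) (gamh : R -> R).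
Variables (dmin dmax Gam Kl : R).
Hypotheses (dmin_gt0 : 0 < dmin) (dmin_dmax : dmin <= dmax).
Hypothesis gam_meas : measurable_fun [set: X * X] (fun z => gam z.1 z.2).
Hypothesis gam_ge0 : forall x x', 0 <= gam x x'.
Hypothesis gam_radial : forall x x', gam x x' = gamh (enorm (x - x')).
Hypotheses (Gam_ge0 : 0 <= Gam) (Kl_ge0 : 0 <= Kl).
Hypothesis gamh_bound : forall a, dmin <= a <= dmax -> `|gamh a| <= Gam.
Hypothesis gamh_lip : forall a b, dmin <= a <= dmax -> dmin <= b <= dmax ->
  `|gamh a - gamh b| <= Kl * `|a - b|.
Implicit Types (u v : X -> R) (d s t : R) (z : X * X).
Local Notation L2n := (nrm (@leb R n)).
Local Notation inL2 := (sqint (@leb R n)).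
Local Notation lebP := (@leb R n \x @leb R n)%E.

(* [aform u v d] is the inner product of [jump d u] and [jump d v]. *)
Definition jump d u z : R :=
  (u z.1 - u z.2) * Num.sqrt (gam z.1 z.2) * \1_(strip (n := n) d) z.

Local Notation Vn d v := (nrm lebP (jump d v)).

Definition energy d u v : R := ip lebP (jump d u) (jump d v).

(** [Vspace] with finiteness of the norm expressed as square integrability of [jump], so that the
    lemmas on [ip] and [nrm] apply to V. *)
Definition inV d v := [/\ inL2 v, {ae leb n, forall x, ~ Omega x -> v x = 0} &
  sqint lebP (jump d v)].

Lemma measurable_strip d : measurable (strip (R := R) (n := n) d).
Proof.
rewrite -[X in measurable X]setTI.
rewrite (_ : strip d = (fun z : X * X => enorm (z.1 - z.2)) @^-1` `]-oo, d]).
  apply: (measurableT_comp (@measurable_enorm R n)) => //.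
  exact: measurable_rVB measurable_fst measurable_snd.
by apply/seteqP; split => z /=; rewrite in_itv.
Qed.

Lemma measurable_jump d u : measurable_fun [set: X] u ->
  measurable_fun [set: X * X] (jump d u).
Proof.
move=> mu; apply: measurable_funM; last first.
  by apply: measurable_indic; exact: measurable_strip.
apply: measurable_funM; first exact: measurable_diff_prod.
apply: (@measurableT_comp _ _ _ _ _ _ (@Num.sqrt R)) => //.
by apply: continuous_measurable_fun; exact: sqrt_continuous.
Qed.

Lemma jump_lin d a b u v :
  jump d (fun x => a * u x + b * v x) = (fun z => a * jump d u z + b * jump d v z).
Proof. by apply/funext => z; rewrite /jump; ring. Qed.

Lemma jumpB d u v : jump d (u \- v) = jump d u \- jump d v.
Proof. by apply/funext => z; rewrite /jump /=; ring. Qed.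

Lemma jumpZ d a u : jump d (fun x => a * u x) = (fun z => a * jump d u z).
Proof. by apply/funext => z; rewrite /jump /=; ring. Qed.

Lemma jump_mul d u v z : jump d u z * jump d v z =
  (u z.1 - u z.2) * (v z.1 - v z.2) * gam z.1 z.2 * \1_(strip (n := n) d) z.
Proof.
rewrite /jump -[in RHS](sqr_sqrtr (gam_ge0 z.1 z.2)) indicE.
by case: (z \in _) => /=; ring.
Qed.

Lemma aformE d u v :
  aform gam u v d = (\int[lebP]_z (jump d u z * jump d v z)%:E)%E.
Proof.
rewrite /aform integral_mkcond; apply: eq_integral => z _.
by rewrite patchE jump_mul indicE; case: ifP; rewrite ?mulr1 ?mulr0.
Qed.

Lemma aform_energy d u v : sqint lebP (jump d u) -> sqint lebP (jump d v) ->
  aform gam u v d = (energy d u v)%:E.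
Proof. by move=> su sv; rewrite aformE ip_EFin. Qed.

Lemma Vnorm_nrm d v : sqint lebP (jump d v) -> Vnorm gam d v = (Vn d v)%:E.
Proof.
move=> sv; rewrite /Vnorm aform_energy// poweR_EFin powR12_sqrt//.
exact: ip_ge0.
Qed.

Lemma VspaceP d v : Vspace Omega gam d v <-> inV d v.
Proof.
split=> [[/Lfun_sqint sv v0 vfin]|[sv v0 sj]].
  split => //; apply: sqint_lty; first exact: measurable_jump sv.1.
  under eq_integral do rewrite expr2.
  by rewrite -aformE (@lty_poweRy _ _ 2^-1).
by split => //; [exact/Lfun_sqint|rewrite Vnorm_nrm// ltry].
Qed.

Lemma inV_lin d a b u v : inV d u -> inV d v ->
  inV d (fun x => a * u x + b * v x).
Proof.
move=> [su u0 ju] [sv v0 jv]; split; first exact: sqint_lin.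
  by apply: filterS2 u0 v0 => x ux vx xO; rewrite ux// vx// !mulr0 addr0.
by rewrite jump_lin; exact: sqint_lin.
Qed.

Lemma inVB d u v : inV d u -> inV d v -> inV d (u \- v).
Proof.
move=> hu hv; have := inV_lin 1 (-1) hu hv; congr inV.
by apply/funext => x; rewrite mul1r mulN1r.
Qed.

Lemma inVZ d a u : inV d u -> inV d (fun x => a * u x).
Proof.
move=> hu; have := inV_lin a 0 hu hu; congr inV.
by apply/funext => x; rewrite mul0r addr0.
Qed.

Lemma energyBl d u v w : inV d u -> inV d v -> inV d w ->
  energy d (u \- v) w = energy d u w - energy d v w.
Proof. by move=> [_ _ su] [_ _ sv] [_ _ sw]; rewrite /energy jumpB ipBl. Qed.

Lemma energyZl d a u w : inV d u -> inV d w ->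
  energy d (fun x => a * u x) w = a * energy d u w.
Proof. by move=> [_ _ su] [_ _ sw]; rewrite /energy jumpZ ipZl. Qed.

(** Inherited from [gam] on the slice where the second argument is 0. *)
Lemma gamh_enorm_meas : measurable_fun [set: X] (fun y : X => gamh (enorm y)).
Proof.
rewrite (_ : (fun y => _) = (fun z => gam z.1 z.2) \o (fun y : X => (y, 0))).
  apply: (measurableT_comp gam_meas); apply/measurable_fun_pairP.
  by split; [exact: measurable_id|exact: measurable_cst].
by apply/funext => y /=; rewrite gam_radial subr0.
Qed.

(** The contribution of the strip of width [s], where the kernel may be singular, cancels. *)
Lemma jump_shell s t u v z : s <= t ->
  jump t u z * jump t v z - jump s u z * jump s v z =
  shell_kernel gamh s t (z.2 - z.1) * ((u z.1 - u z.2) * (v z.1 - v z.2)).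
Proof.
move=> st; rewrite !jump_mul /shell_kernel indic_shell// enormBC -gam_radial.
have E d : \1_(eball d) (z.2 - z.1) = \1_(strip (n := n) d) z :> R.
  by rewrite !indicE; congr (nat_of_bool _)%:R; apply/idP/idP;
    rewrite !inE /eball /strip/= enormBC.
by rewrite !E; ring.
Qed.

Section shells.
Variables (s t : R).
Hypotheses (sd : dmin <= s) (st : s <= t) (td : t <= dmax).

Let W u v z :=
  shell_kernel gamh s t (z.2 - z.1) * ((u z.1 - u z.2) * (v z.1 - v z.2)).

Lemma shell_conv u v : inL2 u -> inL2 v ->
  lebP.-integrable [set: X * X] (EFin \o W u v) /\
  \int[lebP]_z W u v z = shell_form gamh s t u v.
Proof.
move=> su sv; apply: (conv_form _ (measurable_shell s t) (leb_shell_lty s t) _ su sv).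
  exact: shell_kernel_meas gamh_enorm_meas s t.
by move=> y; apply: (shell_kernel_bound gamh_bound).
Qed.

(** The squares of the two jumps differ by [W u u], which is integrable for every L^2 function.
    Hence the spaces V_d coincide as sets. *)
Lemma jump_sqint_shell u : inL2 u ->
  sqint lebP (jump s u) <-> sqint lebP (jump t u).
Proof.
move=> su; have [iW _] := shell_conv su su.
split => -[_ h]; split; try exact: measurable_jump su.1.
- have := integrableD measurableT h iW; apply: eq_integrable => // z _ /=.
  by rewrite -EFinD !expr2 /W -jump_shell// addrCA subrr addr0.
- have := integrableB measurableT h iW; apply: eq_integrable => // z _ /=.
  by rewrite -EFinB !expr2 /W -jump_shell// opprB addrCA subrr addr0.
Qed.

Lemma energy_shell u v : inV s u -> inV s v ->
  energy t u v - energy s u v = shell_form gamh s t u v.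
Proof.
move=> [su _ ju] [sv _ jv].
have ju' := (jump_sqint_shell su).1 ju; have jv' := (jump_sqint_shell sv).1 jv.
have [_ <-] := shell_conv su sv.
rewrite /energy /ip -RintegralB//; [|exact: sqint_mul..].
by congr (Rintegral _ _ _); apply/funext => z; exact: jump_shell.
Qed.

End shells.

Lemma inV_transfer s t v : dmin <= s <= dmax -> dmin <= t <= dmax ->
  inV s v -> inV t v.
Proof.
move=> /andP[s1 s2] /andP[t1 t2] [sv v0 jv]; split => //.
have [st|ts] := leP s t; first exact/(jump_sqint_shell s1 st t2 sv).
exact/(jump_sqint_shell t1 (ltW ts) s2 sv).
Qed.

Definition energy_slope s t u v := (energy t u v - energy s u v) / (t - s).

Lemma energy_slopeC s t u v : energy_slope s t u v = energy_slope t s u v.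
Proof.
by rewrite /energy_slope -opprB -[t - s]opprB invrN mulrNN.
Qed.

Lemma energy_lip : exists2 C : R, 0 <= C & forall s t u v,
  dmin <= s <= dmax -> dmin <= t <= dmax -> inV s u -> inV s v ->
  `|energy t u v - energy s u v| <= C * `|t - s| * (L2n u * L2n v).
Proof.
have [C C0 HC] := shell_form_lip dmin_gt0 dmin_dmax gamh_enorm_meas Gam_ge0 gamh_bound.
exists C => // s t u v sD tD hu hv.
have [[su _ _] [sv _ _]] := (hu, hv).
have [/andP[s1 s2] /andP[t1 t2]] := (sD, tD).
have [st|/ltW ts] := leP s t.
  by rewrite energy_shell// [`|t - s|]ger0_norm ?subr_ge0//; exact: HC.
rewrite distrC energy_shell//; try exact: inV_transfer sD tD _.
by rewrite [`|t - s|]distrC [`|s - t|]ger0_norm ?subr_ge0//; exact: HC.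
Qed.

(** The slope is symmetric in its end points, so each pair can be put in increasing order before
    [shell_form_slope_lip] is applied. *)
Lemma energy_slope_lip : exists2 C : R, 0 <= C & forall s t s' t' u v (M : R),
  dmin <= s <= dmax -> dmin <= t <= dmax ->
  dmin <= s' <= dmax -> dmin <= t' <= dmax -> s != t -> s' != t' ->
  inV s u -> inV s v -> 0 <= M ->
  (forall w, L2n (u \- tr w u) <= M * enorm w) ->
  `|energy_slope s t u v - energy_slope s' t' u v| <=
  C * (`|t - s| + `|t' - s'| + `|s - s'|) * ((L2n u + M) * L2n v).
Proof.
have [C C0 HC] := shell_form_slope_lip dmin_gt0 dmin_dmax gamh_enorm_meas
  Gam_ge0 Kl_ge0 gamh_bound gamh_lip.
(* After ordering, the lower end points differ by at most |s - s'| + |t - s| + |t' - s'|, and so do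
   the upper ones. With the two interval lengths this stays below four copies of that sum. *)
exists (4 * C); first by rewrite mulr_ge0.
move=> s t s' t' u v M sD tD s'D t'D st st' hu hv M0 uM.
have [[su _ _] [sv _ _]] := (hu, hv).
have P0 : 0 <= (L2n u + M) * L2n v by rewrite mulr_ge0 ?addr_ge0 ?nrm_ge0.
have K a b : dmin <= a <= dmax -> dmin <= b <= dmax -> a != b -> exists a' b' : R,
    [/\ dmin <= a', a' < b', b' <= dmax,
      energy_slope a b u v = shell_form gamh a' b' u v / (b' - a') &
      [\/ (a' = a) /\ (b' = b) | (a' = b) /\ (b' = a)]].
  move=> aD bD; have [/andP[a1 a2] /andP[b1 b2]] := (aD, bD).
  have [ab _|ba _|//] := ltgtP a b.
    exists a, b; split => //; last by left.
    by rewrite /energy_slope energy_shell// ?ltW//; exact: inV_transfer sD aD _.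
  exists b, a; split => //; last by right.
  rewrite energy_slopeC /energy_slope energy_shell// ?ltW//;
    exact: inV_transfer sD bD _.
have [a [b [a1 ab b2 -> cab]]] := K s t sD tD st.
have [a' [b' [a1' ab' b2' -> cab']]] := K s' t' s'D t'D st'.
apply: (le_trans (HC u v M a b a' b' su sv M0 uM a1 ab b2 a1' ab' b2')).
rewrite ler_wpM2r// [4 * C]mulrC -mulrA ler_wpM2l//.
have h1 : `|t - s| = b - a.
  by case: cab => -[<- <-]; [|rewrite distrC]; rewrite ger0_norm// subr_ge0 ltW.
have h2 : `|t' - s'| = b' - a'.
  by case: cab' => -[<- <-]; [|rewrite distrC]; rewrite ger0_norm// subr_ge0 ltW.
have h0 : 0 <= `|s - s'| by [].
have t1 := ler_normD (s - s') (s' - t'); have t2 := ler_normD (t - s) (s - s').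
have t3 := ler_normD (t - s) (s - t'); have t4 := ler_normD (s - s') (s' - t').
have e1 : t - s + (s - s') = t - s' by ring.
have e2 : t - s + (s - t') = t - t' by ring.
have e3 : s - s' + (s' - t') = s - t' by ring.
rewrite e1 in t2; rewrite e2 in t3; rewrite e3 in t1 t4.
have t5 := distrC s' t'; rewrite h2 in t5; rewrite t5 in t1 t4.
rewrite h1 in t2 t3 *; rewrite h2.
have [d1 d2] : b - a > 0 /\ b' - a' > 0 by rewrite !subr_gt0.
have hh : `|a - a'| <= `|s - s'| + (b - a) + (b' - a') /\
          `|b - b'| <= `|s - s'| + (b - a) + (b' - a').
  have q1 := distrC s t; rewrite h1 in q1.
  case: cab => -[ea eb]; case: cab' => -[ea' eb'];
    rewrite ea eb ea' eb'; split; lra.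
case: hh; lra.
Qed.

(** * Difference quotients of the solution *)

Section solution.
Variables (CP M : R) (u : R -> X -> R).
Hypotheses (CP_ge0 : 0 <= CP) (M_ge0 : 0 <= M).
Let D := [set d | dmin <= d <= dmax].
Hypothesis poin : forall d v, D d -> inV d v -> L2n v <= CP * Vn d v.
Hypothesis uV : forall d e, D d -> D e -> inV e (u d).
Hypothesis uM : forall d, D d -> L2n (u d) <= M.
Hypothesis uT : forall d, D d -> forall w, L2n (u d \- tr w (u d)) <= M * enorm w.
Hypothesis u_eq : forall s t v, D s -> D t -> inV s v ->
  energy s (u s) v = energy t (u t) v.

Definition dquot s t : X -> R := fun x => (t - s)^-1 * (u t x - u s x).

Lemma inV_dquot d s t : D d -> D s -> D t -> inV d (dquot s t).
Proof. by move=> dD sD tD; apply: inVZ; apply: inVB; exact: uV. Qed.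

(** The right-hand side does not depend on delta, so a(u(s), v; s) may be replaced by a(u(t), v;
    t). *)
Lemma dquot_eq s t v : D s -> D t -> s != t -> inV s v ->
  energy s (dquot s t) v = - energy_slope s t (u t) v.
Proof.
move=> sD tD st vV; rewrite energyZl//; last by apply: inVB; exact: uV.
rewrite energyBl//; try exact: uV.
by rewrite (u_eq sD tD vV) /energy_slope -[energy s _ _ - _]opprB mulrN mulrC.
Qed.

(** Poincare turns the right-hand side into [Q * CP * Vn d v]; then divide by [Vn d v]. A bound of
    the data in L^2 is thus enough. *)
Lemma energy_coercive d v (Q : R) : D d -> inV d v -> 0 <= Q ->
  energy d v v <= Q * L2n v -> Vn d v <= Q * CP.
Proof.
move=> dD vV Q0 h; have [N0|N0] := eqVneq (Vn d v) 0; first by rewrite N0 mulr_ge0.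
have N1 : 0 < Vn d v by rewrite lt_def N0 nrm_ge0.
rewrite -(ler_pM2r N1) -expr2 nrm_sqr (le_trans h)// -mulrA ler_wpM2l//.
exact: poin.
Qed.

Lemma Vn_equiv : exists2 K : R, 0 <= K & forall s t v, D s -> D t -> inV s v ->
  Vn t v <= K * Vn s v.
Proof.
have [C C0 HC] := energy_lip.
(* This constant bounds the ratio of the squared norms, by [energy_lip] and Poincare. It is at least
   1, hence below its own square, so no root is taken. *)
exists (1 + C * (dmax - dmin) * CP ^+ 2).
  by rewrite addr_ge0// !mulr_ge0// ?subr_ge0 ?sqr_ge0.
move=> s t v sD tD vV; set K := C * (dmax - dmin) * CP ^+ 2.
have K0 : 0 <= K by rewrite /K !mulr_ge0// ?subr_ge0 ?sqr_ge0.
have K1 : 1 <= 1 + K by rewrite lerDl.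
rewrite -ler_sqr ?nnegrE ?mulr_ge0 ?nrm_ge0 ?addr_ge0// exprMn.
apply: (@le_trans _ _ ((1 + K) * Vn s v ^+ 2)); last first.
  by rewrite ler_wpM2r ?sqr_ge0// expr2 ler_peMr// (le_trans ler01).
rewrite mulrDl mul1r addrC -lerBlDr !nrm_sqr.
apply: (le_trans (ler_norm _)); apply: (le_trans (HC s t v v sD tD vV vV)).
rewrite -(nrm_sqr lebP) /K -!mulrA ler_wpM2l// ler_pM ?mulr_ge0 ?nrm_ge0//.
  case/andP: sD => s1 s2; case/andP: tD => t1 t2.
  by rewrite ler_norml; apply/andP; split; lra.
rewrite mulrA -[CP * CP]expr2 -exprMn -[leLHS]expr2 ler_sqr.
- exact: poin.
- by rewrite nnegrE nrm_ge0.
- by rewrite nnegrE mulr_ge0 ?nrm_ge0.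
Qed.

(** The equation [dquot_eq] is tested with the quotient itself, and [energy_lip] bounds its
    right-hand side. *)
Lemma dquot_bound : exists2 A : R, 0 <= A & forall s t, D s -> D t -> s != t ->
  L2n (dquot s t) <= A.
Proof.
have [C C0 HC] := energy_lip.
exists (CP * (C * M * CP)); first by rewrite !mulr_ge0.
move=> s t sD tD st; have wV := inV_dquot sD sD tD.
apply: (le_trans (poin sD wV)); rewrite ler_wpM2l//.
apply: energy_coercive => //; first exact: mulr_ge0.
rewrite dquot_eq//; apply: (le_trans (ler_norm _)); rewrite normrN.
rewrite normrM normfV ler_pdivrMr ?normr_gt0 ?subr_eq0 1?eq_sym//.
apply: (le_trans (HC s t (u t) _ sD tD (uV tD sD) wV)).
rewrite -!mulrA ler_wpM2l// mulrC [leRHS]mulrA ler_wpM2r// ler_wpM2r ?nrm_ge0//.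
exact: uM.
Qed.

Lemma u_lip : exists2 A : R, 0 <= A & forall s t, D s -> D t ->
  L2n (u t \- u s) <= A * `|t - s|.
Proof.
have [A A0 HA] := dquot_bound; exists A => // s t sD tD.
have [->|st] := eqVneq s t.
  rewrite subrr normr0 mulr0 (_ : _ \- _ = cst 0).
    rewrite /nrm /ip; under eq_Rintegral do rewrite mul0r.
    by rewrite /Rintegral integral0 sqrtr0.
  by apply/funext => x; rewrite /= subrr.
have ts0 : t - s != 0 by rewrite subr_eq0 eq_sym.
have E : u t \- u s = fun x => (t - s) * dquot s t x.
  by apply/funext => x; rewrite /dquot /= mulVKf.
have [sw _ _] := inV_dquot sD sD tD.
by rewrite E nrmZ// mulrC ler_wpM2r// HA.
Qed.

(* Both difference quotients solve [a(w, v; s) = - slope of a(u, v; .)], and the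
   slopes are Lipschitz in their end points. *)
Lemma dquot_lip d : D d -> exists2 C : R, 0 <= C & forall s t s' t',
  D s -> D t -> D s' -> D t' -> s != t -> s' != t' ->
  Vn d (dquot s t \- dquot s' t') <=
  C * (`|t - s| + `|t' - s'| + `|s - s'|).
Proof.
move=> dD; have [K K0 HK] := Vn_equiv; have [C1 C10 HC1] := energy_lip.
have [C2 C20 HC2] := energy_slope_lip; have [A A0 HA] := dquot_bound.
have [B B0 HB] := u_lip.
(* The three summands come from [F2], [F3] and [F1]; [CP] comes from [energy_coercive], and [K] from
   passing from the norm at [s] to that at [d]. *)
exists (K * ((C1 * B + C2 * (M + M) + C1 * A) * CP)).
  by rewrite !mulr_ge0// !addr_ge0// mulr_ge0// addr_ge0.
move=> s t s' t' sD tD s'D t'D st st'.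
have w1 e (eD : D e) := inV_dquot eD sD tD.
have w2 e (eD : D e) := inV_dquot eD s'D t'D.
set f := _ \- _; pose e : R := `|t - s| + `|t' - s'| + `|s - s'|.
rewrite -/e.
have e0 : 0 <= e by rewrite /e !addr_ge0.
have fV c (cD : D c) : inV c f by exact: inVB (w1 c cD) (w2 c cD).
apply: (le_trans (HK s d f sD dD (fV s sD))); rewrite -!mulrA ler_wpM2l//.
rewrite [CP * e]mulrC mulrA.
apply: energy_coercive => //; first exact: fV.
  by rewrite mulr_ge0// !addr_ge0// mulr_ge0// addr_ge0.
have [sf _ _] := fV s sD.
have E1 := dquot_eq sD tD st (fV s sD).
have E2 := dquot_eq s'D t'D st' (fV s' s'D).
have E3 : energy s f f = energy s (dquot s t) f - energy s (dquot s' t') f.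
  by rewrite energyBl//; [exact: w1|exact: w2|exact: fV].
(* The second quotient solves an equation at [s']; this is the cost of moving it to the form at
   [s]. *)
have F1 : `|energy s (dquot s' t') f - energy s' (dquot s' t') f| <=
    C1 * e * (A * L2n f).
  apply: (le_trans (HC1 s' s _ f s'D sD (w2 s' s'D) (fV s' s'D))).
  have LA := HA s' t' s'D t'D st'.
  apply: ler_pM; rewrite ?mulr_ge0 ?nrm_ge0//.
    by rewrite ler_wpM2l// /e lerDr addr_ge0.
  by rewrite ler_wpM2r ?nrm_ge0.
(* No small translation constant is available for u(t) - u(t'), but its L^2 norm is small by
   [u_lip], and [energy_lip] needs nothing more. *)
have F2 : `|energy_slope s t (u t \- u t') f| <= C1 * (B * e) * L2n f.
  rewrite normrM normfV ler_pdivrMr ?normr_gt0 ?subr_eq0 1?eq_sym//.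
  apply: (le_trans (HC1 s t _ f sD tD (inVB (uV tD sD) (uV t'D sD)) (fV s sD))).
  have -> : C1 * (B * e) * L2n f * `|t - s| = C1 * `|t - s| * (B * e * L2n f).
    by move: (L2n f) `|t - s| => a b; ring.
  rewrite ler_wpM2l ?mulr_ge0// ler_wpM2r ?nrm_ge0//.
  apply: (le_trans (HB t' t t'D tD)); rewrite ler_wpM2l// /e.
  have -> : t - t' = (t - s) + (s' - t') + (s - s') by ring.
  rewrite (le_trans (ler_normD _ _))// lerD2r (le_trans (ler_normD _ _))//.
  by rewrite (distrC s').
have F3 : `|energy_slope s t (u t') f - energy_slope s' t' (u t') f| <=
    C2 * e * ((M + M) * L2n f).
  apply: (le_trans (HC2 s t s' t' _ f M sD tD s'D t'D st st' (uV t'D sD)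
    (fV s sD) M_ge0 (uT t'D))).
  by rewrite ler_wpM2l ?mulr_ge0// ler_wpM2r ?nrm_ge0// lerD2r uM.
have F4 : energy_slope s t (u t \- u t') f =
    energy_slope s t (u t) f - energy_slope s t (u t') f.
  rewrite /energy_slope energyBl; [|exact: uV|exact: uV|exact: fV].
  rewrite energyBl; [|exact: uV|exact: uV|exact: fV].
  rewrite -mulrBl; congr (_ / _); ring.
rewrite F4 in F2.
have -> : (C1 * B + C2 * (M + M) + C1 * A) * e * L2n f =
  C1 * (B * e) * L2n f + C2 * e * ((M + M) * L2n f) + C1 * e * (A * L2n f) by ring.
(* Three errors: the change of the solution, of the slope and of the form. *)
have -> : energy s f f =
  - (energy_slope s t (u t) f - energy_slope s t (u t') f)
  - (energy_slope s t (u t') f - energy_slope s' t' (u t') f)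
  - (energy s (dquot s' t') f - energy s' (dquot s' t') f).
  rewrite E3 E1 E2.
  move: (energy_slope s t (u t) f) (energy_slope s t (u t') f)
    (energy_slope s' t' (u t') f) (energy s (dquot s' t') f) => a b c g.
  by ring.
move: F1 F2 F3; rewrite !ler_norml => /andP[f1 _] /andP[f2 _] /andP[f3 _].
by rewrite !lerD// lerNl.
Qed.

End solution.
End energy.

(** * Completeness *)

Section fatou.
Context d (T : measurableType d) (R : realType).
Variable mu : {measure set T -> \bar R}.

(** Lower semicontinuity of the norm under a.e. convergence: Fatou's lemma for the squares, with f^2
    equal a.e. to the limit inferior. *)
Lemma fatou_sqint (f_ : (T -> R)^nat) (f : T -> R) (B : R) : 0 <= B ->
  (forall k, sqint mu (f_ k)) -> measurable_fun [set: T] f ->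
  {ae mu, forall x, (fun k => f_ k x) @ \oo --> f x} ->
  (forall k, nrm mu (f_ k) <= B) -> sqint mu f /\ nrm mu f <= B.
Proof.
move=> B0 sf mf ff fB.
pose F k x := ((f_ k x) ^+ 2)%:E.
have mF k : measurable_fun [set: T] (F k).
  by apply/measurable_EFinP; apply: measurable_funX; exact: (sf k).1.
have E : (\int[mu]_x (f x ^+ 2)%:E = \int[mu]_x limn_einf (F^~ x))%E.
  apply: ge0_ae_eq_integral => //.
  - by apply/measurable_EFinP; exact: measurable_funX.
  - rewrite /limn_einf; apply: measurableT_comp => //.
    apply: measurable_fun_limn_esup => k.
    by apply: measurableT_comp => //; exact: mF.
  - by move=> x _; rewrite lee_fin sqr_ge0.
  - move=> x _; rewrite limn_einf_lim; apply: lime_ge; first exact: is_cvg_einfs.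
    apply: nearW => k; apply: le_ereal_inf_tmp => _ [m _ <-].
    by rewrite lee_fin sqr_ge0.
  apply: filterS ff => x fx _; apply/esym.
  have h : (fun k => F k x) @ \oo --> (f x ^+ 2)%:E.
    apply: cvg_EFin; first exact: nearW.
    by rewrite expr2; exact: (cvgM fx fx).
  by have [] := cvg_limn_einf_sup h.
have le : (\int[mu]_x (f x ^+ 2)%:E <= (B ^+ 2)%:E)%E.
  rewrite E; apply: le_trans (fatou mu measurableT mF _) _.
    by move=> k x _; rewrite lee_fin sqr_ge0.
  rewrite limn_einf_lim; apply: lime_le; first exact: is_cvg_einfs.
  apply: nearW => k; apply: (@le_trans _ _ (\int[mu]_x F k x)%E).
    by apply: ereal_inf_lbound; exists k => /=.
  rewrite -nrm_sqr_EFin// lee_fin lerXn2r// ?nnegrE ?nrm_ge0//.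
have sff : sqint mu f by apply: sqint_lty => //; apply: le_lt_trans le _; exact: ltry.
split => //; rewrite -ler_sqr ?nnegrE ?nrm_ge0//.
by rewrite -lee_fin nrm_sqr_EFin.
Qed.

(* The weighted sum of 2^k |f_(k+1) - f_k|^2 has a finite integral, and
   |a| <= 2^k a^2 + 2^-k. *)
Lemma ae_cvg_of_summable (f_ : (T -> R)^nat) (c : R) : 0 <= c ->
  (forall k, sqint mu (f_ k)) ->
  (forall k, nrm mu (f_ k.+1 \- f_ k) <= c * 2^-1 ^+ k) ->
  {ae mu, forall x, cvgn (fun k => f_ k x)}.
Proof.
move=> c0 sf fc; pose D k x := (2 ^+ k * (f_ k.+1 x - f_ k x) ^+ 2)%:E : \bar R.
have sD k := sqintB (sf k.+1) (sf k).
have D0 k x : (0 <= D k x)%E by rewrite lee_fin mulr_ge0 ?sqr_ge0// exprn_ge0.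
have mD k : measurable_fun [set: T] (D k).
  apply/measurable_EFinP; apply: measurable_funM => //.
  by apply: measurable_funX; exact: (sD k).1.
(* The bound 2^k (c / 2^k)^2 is written as 2 c^2 / 2^(k + 1), the form that [epsilon_trick0] sums to
   at most 2 c^2. *)
have ID k : (\int[mu]_x D k x <= ((2 * c ^+ 2) / (2 ^ k.+1)%:R)%:E)%E.
  under eq_integral do rewrite /D EFinM.
  rewrite integralZl//; last exact: (sD k).2.
  rewrite -(nrm_sqr_EFin (sD k)) -EFinM lee_fin.
  apply: (@le_trans _ _ (2 ^+ k * (c * 2^-1 ^+ k) ^+ 2)).
    rewrite ler_wpM2l ?exprn_ge0// lerXn2r ?nnegrE ?nrm_ge0 ?mulr_ge0 ?exprn_ge0//.
  rewrite natrX [2 ^+ k.+1]exprS exprVn le_eqVlt; apply/orP; left; apply/eqP.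
  by field; rewrite expf_neq0.
have Ioo : (\int[mu]_x (\sum_(k <oo) D k x) < +oo)%E.
  rewrite integral_nneseries//.
  apply: le_lt_trans (ltry (2 * c ^+ 2)).
  apply: le_trans (epsilon_trick0 xpredT _); last by rewrite mulr_ge0 ?sqr_ge0.
  by apply: lee_nneseries => [k _ _|k _]; [exact: integral_ge0|exact: ID].
have iS : mu.-integrable [set: T] (fun x => \sum_(k <oo) D k x)%E.
  apply/integrableP; split.
    by apply: ge0_emeasurable_sum => // k x _ _; exact: D0.
  under eq_integral do rewrite gee0_abs ?nneseries_ge0//.
  exact: Ioo.
have := integrable_ae measurableT iS; apply: filterS => x /(_ Logic.I) fx.
pose u k := f_ k x.
suff h : cvgn (series (telescope u)).
  rewrite telescopeK in h.
  have -> : (fun k => f_ k x) = [sequence u k - u 0%N]_k \+ cst (u 0%N).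
    by apply/funext => k /=; rewrite subrK.
  by apply: is_cvgD => //; exact: is_cvg_cst.
apply: normed_cvg; apply: nondecreasing_is_cvgn.
  by apply: nondecreasing_series => k _ _; exact: normr_ge0.
exists (fine (\sum_(k <oo) D k x)%E + 2) => _ [m _ <-].
rewrite -[leLHS]/(\sum_(0 <= k < m) `|u k.+1 - u k|).
have S1 : \sum_(0 <= k < m) 2 ^+ k * (u k.+1 - u k) ^+ 2 <= fine (\sum_(k <oo) D k x)%E.
  rewrite -lee_fin fineK// -sumEFin; apply: nneseries_lim_ge => k _ _.
  exact: D0.
have S2 : \sum_(0 <= k < m) (2^-1 : R) ^+ k <= 2.
  have -> : \sum_(0 <= k < m) (2^-1 : R) ^+ k = 2 - 2 * 2^-1 ^+ m.
    elim: m {S1} => [|m IH]; first by rewrite big_geq// expr0 mulr1 subrr.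
    by rewrite big_nat_recr//= IH exprS; field.
  by rewrite gerBl mulr_ge0// exprn_ge0.
apply: le_trans (lerD S1 S2); rewrite -big_split/=; apply: ler_sum => k _.
rewrite -[2 ^+ k]invrK -exprVn.
have p0 : 0 < (2^-1 : R) ^+ k by rewrite exprn_gt0.
rewrite -[(u k.+1 - u k) ^+ 2]real_normK ?num_real//.
move: (_ ^+ k) `|u k.+1 - u k| p0 (normr_ge0 (u k.+1 - u k)) => p a p0 a0.
have -> : p^-1 * a ^+ 2 + p = (a ^+ 2 + p ^+ 2) / p by field; rewrite gt_eqF.
rewrite ler_pdivlMr//; nra.
Qed.

End fatou.

(** A null set times the whole space is null even for an infinite factor, since 0 times +oo is 0. *)
Lemma ae_prod d1 d2 (T1 : measurableType d1) (T2 : measurableType d2)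
    (R : realType) (m1 : {sigma_finite_measure set T1 -> \bar R})
    (m2 : {sigma_finite_measure set T2 -> \bar R}) (P : set T1) (Q : set T2) :
  {ae m1, forall x, P x} -> {ae m2, forall y, Q y} ->
  {ae (m1 \x m2)%E, forall z, P z.1 /\ Q z.2}.
Proof.
move=> [A [mA A0 PA]] [B [mB B0 QB]]; apply: filterS2.
- by move=> z Pz Qz; split; [exact: Pz|exact: Qz].
- exists (A `*` setT); split; first exact: measurableX.
    transitivity (m1 A * m2 setT)%E; first exact: product_measure1E.
    by rewrite A0 mul0e.
  by move=> z /= Pz; split => //; exact: PA.
- exists (setT `*` B); split; first exact: measurableX.
    transitivity (m1 setT * m2 B)%E; first exact: product_measure1E.
    by rewrite B0 mule0.
  by move=> z /= Qz; split => //; exact: QB.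
Qed.

Section completeness.
Context {R : realType} {n : nat}.
Local Notation X := 'rV[R]_n.
Variables (Omega : set X) (gam : X -> X -> R).
Hypothesis gam_meas : measurable_fun [set: X * X] (fun z => gam z.1 z.2).
Local Notation lebP := (@leb R n \x @leb R n)%E.
Local Notation Vn d v := (nrm lebP (jump gam d v)).

(** The geometric rate passes to L^2 by Poincare and gives a.e. convergence of the whole sequence.
    The jumps then converge a.e. on the product, and Fatou identifies the limit in V. *)
Lemma inV_complete (d CP c : R) (w : (X -> R)^nat) : 0 <= CP -> 0 <= c ->
  (forall v, inV Omega gam d v -> nrm (leb n) v <= CP * Vn d v) ->
  (forall k, inV Omega gam d (w k)) ->
  (forall k l, (k <= l)%N -> Vn d (w k \- w l) <= c * 2^-1 ^+ k) ->
  exists2 g, inV Omega gam d g & forall k, Vn d (w k \- g) <= c * 2^-1 ^+ k.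
Proof.
move=> CP0 c0 poin wV wc.
have sw k : sqint (leb n) (w k) by case: (wV k).
have sj k : sqint lebP (jump gam d (w k)) by case: (wV k).
have wL k l : (k <= l)%N -> nrm (leb n) (w k \- w l) <= CP * c * 2^-1 ^+ k.
  move=> kl; rewrite -mulrA (le_trans (poin _ (inVB (wV k) (wV l))))//.
  by rewrite ler_wpM2l// wc.
have aec : {ae leb n, forall x, cvgn (fun k => w k x)}.
  apply: (@ae_cvg_of_summable _ _ _ _ w (CP * c)) => //; first exact: mulr_ge0.
  by move=> k; rewrite nrmBC; exact: wL.
(* The limit superior is defined at every point and measurable, and it is the limit wherever that
   exists. *)
pose g x := fine (limn_esup (fun k => (w k x)%:E)).
have mg : measurable_fun [set: X] g.
  apply: measurableT_comp => //; apply: measurable_fun_limn_esup => k.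
  by apply/measurable_EFinP; exact: (sw k).1.
have wg : {ae leb n, forall x, (fun k => w k x) @ \oo --> g x}.
  apply: filterS aec => x /cvg_ex[l wl].
  have h : (fun k => (w k x)%:E) @ \oo --> l%:E.
    by apply: cvg_EFin => //; exact: nearW.
  by rewrite /g; have [_ ->] := cvg_limn_einf_sup h.
have shiftc (f : R^nat) (l : R) k : f @ \oo --> l -> (fun m => f (m + k)%N) @ \oo --> l.
  by move=> fl; rewrite cvg_shiftn.
have sg : sqint (leb n) g.
  have [||||h _] := @fatou_sqint _ _ _ (leb n) (fun m => w 0%N \- w m) (w 0%N \- g)
    (CP * c) (mulr_ge0 CP0 c0).
  - by move=> k; exact: sqintB.
  - by apply: measurable_funB => //; exact: (sw 0%N).1.
  - apply: filterS wg => x wx; apply: cvgB => //; exact: cvg_cst.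
  - by move=> k; rewrite -[leRHS]mulr1 -(expr0 2^-1); exact: wL.
  have := sqintB (sw 0%N) h; congr sqint.
  by apply/funext => x /=; rewrite opprB addrC subrK.
have g0 : {ae leb n, forall x, ~ Omega x -> g x = 0}.
  have w0 : {ae leb n, forall x k, ~ Omega x -> w k x = 0}.
    by apply/ae_foralln => k; case: (wV k).
  apply: filterS2 w0 wg => x wx gx xO.
  rewrite -(cvg_lim _ gx)//; apply: cvg_lim => //.
  by under eq_fun do rewrite wx//; exact: cvg_cst.
have jg : {ae lebP, forall z, (fun k => jump gam d (w k) z) @ \oo --> jump gam d g z}.
  apply: filterS (ae_prod wg wg) => z [z1 z2].
  apply: cvgM; last exact: cvg_cst.
  by apply: cvgM; [exact: cvgB|exact: cvg_cst].
have K k : sqint lebP (jump gam d (w k) \- jump gam d g) /\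
    nrm lebP (jump gam d (w k) \- jump gam d g) <= c * 2^-1 ^+ k.
  (* Here [k] is fixed and m tends to infinity; the index m + k is always at least k, as [wc]
     requires. *)
  apply: (@fatou_sqint _ _ _ _ (fun m => jump gam d (w k) \- jump gam d (w (m + k)%N))).
  - by rewrite mulr_ge0// exprn_ge0.
  - by move=> m; exact: sqintB.
  - by apply: measurable_funB; [exact: (sj k).1|exact: measurable_jump].
  - apply: filterS jg => z jz; apply: cvgB; first exact: cvg_cst.
    exact: (shiftc (fun k => jump gam d (w k) z)).
  - by move=> m; rewrite -jumpB wc// leq_addl.
exists g; last by move=> k; rewrite jumpB; exact: (K k).2.
split => //; have := sqintB (sj 0%N) (K 0%N).1; congr sqint.
by apply/funext => z /=; rewrite opprB addrC subrK.
Qed.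

End completeness.

(** * The derivative of the solution *)

(** Move to the right of [s], or to the left if [s = b], so that end points of the interval are
    covered too. *)
Lemma itv_approx (R : realFieldType) (a b s e : R) : a < b -> a <= s <= b -> 0 < e ->
  exists t, [/\ a <= t <= b, s != t & `|t - s| <= e].
Proof.
move=> ab /andP[as_ sb] e0; have [sb'|bs] := ltP s b.
  exists (Num.min b (s + e)); split.
  - by rewrite le_min ge_min lexx andbT (ltW ab) (le_trans as_)//= lerDl ltW.
  - by rewrite lt_eqF// lt_min sb' ltrDl.
  - rewrite ger0_norm; last by rewrite subr_ge0 le_min sb lerDl ltW.
    by rewrite lerBlDl ge_min lexx orbT.
exists (Num.max a (s - e)); split.
- by rewrite le_max lexx ge_max (ltW ab)/= (le_trans _ sb)// gerBl ltW.
- by rewrite gt_eqF// gt_max (lt_le_trans ab bs) gtrBl.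
- rewrite distrC ger0_norm; last by rewrite subr_ge0 ge_max as_ gerBl ltW.
  by rewrite lerBlDl -lerBlDr le_max lexx orbT.
Qed.

(** * Limits of the difference quotients *)

Section limit_quotient.
Context {R : realType} {n : nat}.
Local Notation X := 'rV[R]_n.
Variables (Omega : set X) (gam : X -> X -> R).
Hypothesis gam_meas : measurable_fun [set: X * X] (fun z => gam z.1 z.2).
Local Notation lebP := (@leb R n \x @leb R n)%E.
Local Notation Vn d v := (nrm lebP (jump gam d v)).
Variables (dmin dmax d CP C : R) (u : R -> X -> R).
Hypotheses (dmin_dmax : dmin < dmax) (CP_ge0 : 0 <= CP) (C_ge0 : 0 <= C).
Let D := [set s | dmin <= s <= dmax].
Hypothesis poin : forall v, inV Omega gam d v -> nrm (leb n) v <= CP * Vn d v.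
Hypothesis wV : forall s t, D s -> D t -> inV Omega gam d (dquot u s t).
Hypothesis w_lip : forall s t s' t', D s -> D t -> D s' -> D t' -> s != t -> s' != t' ->
  Vn d (dquot u s t \- dquot u s' t') <= C * (`|t - s| + `|t' - s'| + `|s - s'|).

Lemma dquot_cvg s : D s -> exists2 g, inV Omega gam d g &
  forall t, D t -> s != t -> Vn d (dquot u s t \- g) <= C * `|t - s|.
Proof.
move=> sD.
have /choice[t tP] k : exists t, [/\ D t, s != t & `|t - s| <= 2^-1 ^+ k].
  by apply: itv_approx => //; exact: exprn_gt0.
have tl k l : (k <= l)%N ->
    Vn d (dquot u s (t k) \- dquot u s (t l)) <= 2 * C * 2^-1 ^+ k.
  move=> kl; have [t1 t2 t3] := tP k; have [l1 l2 l3] := tP l.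
  apply: (le_trans (w_lip sD t1 sD l1 t2 l2)); rewrite mulrAC mulrC ler_wpM2r//.
  rewrite subrr normr0 addr0 mulr_natl mulr2n lerD// (le_trans l3)//.
  by rewrite ler_wiXn2l// invr_le1 ?unitfE// ler1n.
have [g gV gc] := inV_complete gam_meas CP_ge0 (mulr_ge0 (ler0n R 2) C_ge0) poin
  (fun k => wV sD (let: And3 h _ _ := tP k in h)) tl.
exists g => // r rD sr; have [_ _ jg] := gV; have [_ _ jr] := wV sD rD.
apply/ler_addgt0Pr => e e0.
(* Passing through t_k costs C 2^-k for |t_k - s| and 2 C 2^-k for the distance to the limit; the
   additional 1 is slack. *)
have [k _ /(_ k (leqnn k)) hk] : \forall k \near \oo, `|(3 * C + 1) * 2^-1 ^+ k| < e.
  have h : (fun k => (3 * C + 1) * 2^-1 ^+ k) @ \oo --> (0 : R).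
    rewrite -(mulr0 (3 * C + 1)); apply: cvgM; first exact: cvg_cst.
    by apply: cvg_expr; rewrite ger0_norm// invf_lt1// ltr1n.
  by move/cvgr0Pnorm_lt : h => /(_ e e0).
have [t1 t2 t3] := tP k; have [_ _ jt] := wV sD t1.
rewrite jumpB; apply: (le_trans (nrmB3 jr jt jg)).
rewrite -!jumpB; apply: (le_trans (lerD (w_lip sD rD sD t1 sr t2) (gc k))).
rewrite subrr normr0 addr0 mulrDr -addrA lerD2l.
apply: (le_trans _ (ltW hk)); apply: (le_trans _ (ler_norm _)).
have p0 : 0 <= (2^-1 : R) ^+ k by exact: exprn_ge0.
apply: (@le_trans _ _ (C * 2^-1 ^+ k + 2 * C * 2^-1 ^+ k)).
  by rewrite lerD2r ler_wpM2l.
by rewrite -!mulrDl ler_wpM2r//; lra.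
Qed.

Lemma dquot_limit_lip s s' g g' : D s -> D s' -> inV Omega gam d g -> inV Omega gam d g' ->
  (forall t, D t -> s != t -> Vn d (dquot u s t \- g) <= C * `|t - s|) ->
  (forall t, D t -> s' != t -> Vn d (dquot u s' t \- g') <= C * `|t - s'|) ->
  Vn d (g \- g') <= C * `|s - s'|.
Proof.
move=> sD s'D [_ _ jg] [_ _ jg'] Hg Hg'; apply/ler_addgt0Pr => e e0.
(* [C * |t - s|] and [C * |t' - s'|] each occur twice, so each may be e / 4. Using C + 1 keeps the
   denominator positive. *)
have q0 : 0 < e / (4 * (C + 1)) by rewrite divr_gt0// mulr_gt0// ltr_wpDl.
have [t [tD st te]] := itv_approx dmin_dmax sD q0.
have [t' [t'D st' te']] := itv_approx dmin_dmax s'D q0.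
have [_ _ jt] := wV sD tD; have [_ _ jt'] := wV s'D t'D.
rewrite jumpB; apply: (le_trans (nrmB3 jg jt jg')).
apply: (le_trans (lerD (lexx _) (nrmB3 jt jt' jg'))).
rewrite nrmBC -!jumpB.
have h1 := Hg t tD st; have h2 := Hg' t' t'D st'.
have h3 := w_lip sD tD s'D t'D st st'.
apply: (le_trans (lerD h1 (lerD h3 h2))).
have h4 : C * `|t - s| <= e / 4.
  apply: (@le_trans _ _ ((C + 1) * (e / (4 * (C + 1))))).
    by rewrite ler_pM// lerDl.
  rewrite le_eqVlt; apply/orP; left; apply/eqP; field.
  by rewrite gt_eqF// ltr_wpDl.
have h5 : C * `|t' - s'| <= e / 4.
  apply: (@le_trans _ _ ((C + 1) * (e / (4 * (C + 1))))).
    by rewrite ler_pM// lerDl.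
  rewrite le_eqVlt; apply/orP; left; apply/eqP; field.
  by rewrite gt_eqF// ltr_wpDl.
rewrite !mulrDr; lra.
Qed.

End limit_quotient.

(** The Lipschitz property says that all sufficiently large constants work; [|K| + 1] is one of them
    and is nonnegative. *)
Lemma lipschitz_itv_const (R : realType) (f : R -> R) (a b : R) :
  [lipschitz f x | x in `[a, b]] -> exists2 K : R, 0 <= K &
  forall x y, a <= x <= b -> a <= y <= b -> `|f x - f y| <= K * `|x - y|.
Proof.
move=> [K [_ HK]]; exists (`|K| + 1); first by rewrite addr_ge0.
move=> x y xab yab; have := HK (`|K| + 1).
rewrite ltr_pwDr ?ler_norm// => /(_ isT (x, y)); apply.
by split; rewrite /= in_itv.
Qed.

(** [L2norm] sees the restriction of [v] to [Omega], which equals [v] a.e. *)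
Lemma poincare_nrm (R : realType) (n : nat) (Omega : set 'rV[R]_n)
    (gam : 'rV[R]_n -> 'rV[R]_n -> R) (CP d : R) (v : 'rV[R]_n -> R) :
  measurable Omega ->
  (L2norm Omega v <= CP%:E * Vnorm gam d v)%E -> inV Omega gam d v ->
  (forall x x', 0 <= gam x x') ->
  nrm (leb n) v <= CP * nrm (leb n \x leb n)%E (jump gam d v).
Proof.
move=> mO le [sv v0 jv] gam_ge0.
have mV : measurable_fun [set: 'rV[R]_n] (v \_ Omega).
  apply/(measurable_restrictT _ mO); exact: measurable_funTS sv.1.
have aev : {ae leb n, forall x, (v \_ Omega) x = v x}.
  apply: filterS v0 => x vx; rewrite patchE; case: ifPn => // /negP.
  by rewrite inE => /vx.
have [sV <-] := ae_sqint aev mV sv.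
by move: le; rewrite (L2normE ((L2P _ _).2 sV)) Vnorm_nrm// -EFinM lee_fin.
Qed.

Theorem corollary3p1 (R : realType) (n : nat) (n_gt0 : (0 < n)%N)
    (Omega : set 'rV[R]_n) (Omega_dom : lipschitz_domain Omega)
    (dmin dmax : R) (dmin_gt0 : 0 < dmin) (dmin_lt_dmax : dmin < dmax)
    (gam : 'rV[R]_n -> 'rV[R]_n -> R)
    (gam_meas : measurable_fun [set: 'rV[R]_n * 'rV[R]_n]
                  (fun z => gam z.1 z.2))
    (gam_ge0 : forall x x', 0 <= gam x x')
    (gam_sym : forall x x', gam x x' = gam x' x)
    (gamh : R -> R)
    (gam_H1 : hypH1 gam dmin dmax)
    (gam_H2 : hypH2 gam dmin dmax gamh)
    (gam_H3 : hypH3 n dmin dmax gamh)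
    (gam_radial : forall x x', gam x x' = gamh (enorm (x - x')))
    (gamh_lip : [lipschitz gamh xi | xi in `[dmin, dmax]])
    (gam_poincare : poincare Omega gam dmin dmax)
    (dstar : R) (dstar_in : dmin <= dstar <= dmax)
    (F : 'rV[R]_n -> R) (F_L2 : L2 Omega F)
    (u : R -> 'rV[R]_n -> R)
    (u_V : forall delta, dmin <= delta <= dmax ->
       Vspace Omega gam dstar (u delta))
    (u_sol : forall delta, dmin <= delta <= dmax ->
       forall v, Vspace Omega gam dstar v ->
         aform gam (u delta) v delta =
           (\int[leb n]_(x in Omega) (F x * v x)%:E)%E)
    (u_H10 : forall delta, dmin <= delta <= dmax -> H10 Omega (u delta))
    (u_H10_bounded :
       (ereal_sup [set H1norm Omega (u delta) | delta in `[dmin, dmax]]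
          < +oo)%E) :
  V_C11 Omega gam `[dmin, dmax] dstar u.
Proof.
have mO : measurable Omega by case: Omega_dom => _ oO _ _ _; exact: open_rV_measurable.
have [Kl Kl0 HKl] := lipschitz_itv_const gamh_lip.
pose Gam : R := `|gamh dmin| + Kl * (dmax - dmin).
have ddW := ltW dmin_lt_dmax.
have Gam0 : 0 <= Gam by rewrite addr_ge0// mulr_ge0// subr_ge0.
have HGam a : dmin <= a <= dmax -> `|gamh a| <= Gam.
  move=> aD; rewrite -[gamh a](subrK (gamh dmin)) addrC.
  rewrite (le_trans (ler_normD _ _))// lerD2l (le_trans (HKl _ _ aD _))//.
    by rewrite lexx.
  rewrite ler_wpM2l//; case/andP: aD => a1 a2.
  by rewrite ger0_norm ?subr_ge0// lerB.
have [CP CP0 HCP] := gam_poincare.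
have poin d v : dmin <= d <= dmax -> inV Omega gam d v ->
    nrm (leb n) v <= CP * nrm (leb n \x leb n)%E (jump gam d v).
  move=> dD vV; apply: (poincare_nrm mO _ vV gam_ge0); apply: HCP => //.
  exact/(VspaceP Omega gam_meas gam_ge0).
have transf s t v : dmin <= s <= dmax -> dmin <= t <= dmax ->
    inV Omega gam s v -> inV Omega gam t v.
  exact: (inV_transfer gam_meas gam_ge0 gam_radial HGam).
have uV d e : dmin <= d <= dmax -> dmin <= e <= dmax -> inV Omega gam e (u d).
  move=> dD eD; apply: (transf dstar) => //.
  exact/(VspaceP Omega gam_meas gam_ge0)/u_V.
have [M0 M00 HM0] : exists2 M : R, 0 <= M &
    forall d, dmin <= d <= dmax -> (H1norm Omega (u d) <= M%:E)%E.
  move: u_H10_bounded; set S := ereal_sup _ => Soo.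
  (* The maximum with 0 excludes -oo, so that [fine] returns the true value. *)
  exists (fine (maxe S 0)); first by rewrite fine_ge0// le_max lexx orbT.
  move=> d dD; have Sd : (H1norm Omega (u d) <= S)%E.
    by apply: ereal_sup_ubound; exists d => //=; rewrite in_itv.
  apply: (le_trans Sd); rewrite fineK ?le_max ?lexx//.
  rewrite ge0_fin_numE; first by rewrite gt_max Soo ltry.
  by rewrite le_max lexx orbT.
(* One constant that dominates both the L^2 bound M0 and the translation constant n M0. *)
pose M : R := n.+1%:R * M0.
have M_ge0 : 0 <= M by rewrite mulr_ge0.
have HH d (dD : dmin <= d <= dmax) :
    [/\ sqint (leb n) (u d), nrm (leb n) (u d) <= M0 &
     forall w, nrm (leb n) (u d \- tr w (u d)) <= n%:R * M0 * enorm w].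
  have [su u0 _] := uV d d dD dD.
  exact: (H10_tr su.1 u0 (u_H10 d dD) (HM0 d dD)).
have uM d : dmin <= d <= dmax -> nrm (leb n) (u d) <= M.
  by move=> /HH[_ h _]; rewrite (le_trans h)// ler_peMl// ler1n.
have uT d : dmin <= d <= dmax -> forall w,
    nrm (leb n) (u d \- tr w (u d)) <= M * enorm w.
  move=> /HH[_ _ h] w; rewrite (le_trans (h w))// ler_wpM2r ?enorm_ge0//.
  by rewrite ler_wpM2r// ler_nat.
have u_eq s t v : dmin <= s <= dmax -> dmin <= t <= dmax -> inV Omega gam s v ->
    energy gam s (u s) v = energy gam t (u t) v.
  move=> sD tD vV.
  have vV' : Vspace Omega gam dstar v.
    by apply/(VspaceP Omega gam_meas gam_ge0); exact: transf vV.
  have [_ _ jv] := vV; have [_ _ jv'] := transf s t v sD tD vV.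
  have [_ _ js] := uV s s sD sD; have [_ _ jt] := uV t t tD tD.
  have := u_sol s sD v vV'; rewrite -(u_sol t tD v vV') !aform_energy//.
  by move=> -[].
have [C C0 HC] := dquot_lip dmin_gt0 ddW gam_meas gam_ge0 gam_radial Gam0 Kl0 HGam
  HKl (ltW CP0) M_ge0 poin uV uM uT u_eq dstar_in.
have wV s t : dmin <= s <= dmax -> dmin <= t <= dmax ->
    inV Omega gam dstar (dquot u s t).
  by move=> sD tD; exact: (inV_dquot uV dstar_in sD tD).
have poin_s v := poin dstar v dstar_in.
(* Choice ranges over all reals; outside the interval the value 0 is a dummy. *)
have /choice[du Hdu] s : exists g, dmin <= s <= dmax -> inV Omega gam dstar g /\
    forall t, dmin <= t <= dmax -> s != t ->
    nrm (leb n \x leb n)%E (jump gam dstar (dquot u s t \- g)) <= C * `|t - s|.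
  have [sD|_] := boolP (dmin <= s <= dmax); last by exists (cst 0).
  have [g gV Hg] := dquot_cvg gam_meas dmin_lt_dmax (ltW CP0) C0 poin_s wV HC sD.
  by exists g.
have itvE s : [set` `[dmin, dmax]] s = (dmin <= s <= dmax) :> Prop.
  by rewrite /= in_itv.
split; first by move=> s; rewrite itvE => /u_V.
exists du; split; last first.
  exists C => s s'; rewrite !itvE => sD s'D.
  have [gV Hg] := Hdu s sD; have [gV' Hg'] := Hdu s' s'D.
  have [_ _ jg] := inVB gV gV'.
  rewrite Vnorm_nrm// lee_fin.
  exact: (dquot_limit_lip dmin_lt_dmax C0 wV HC sD s'D gV gV' Hg Hg').
move=> s; rewrite itvE => sD; have [gV Hg] := Hdu s sD.
split; first exact/(VspaceP Omega gam_meas gam_ge0).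
apply: (@squeeze_cvge _ _ _ _ (cst 0%E) _ (fun h => (C * `|h|)%:E)).
- near=> h.
  (* The filter supplies h != 0 and s + h in the interval, so at an end point the limit is
     one-sided. *)
  have h0 : h != 0 by near: h; exact: (cvg_within _ (nbhs_dnbhs_neq (0 : R))).
  have shD : dmin <= s + h <= dmax.
    by rewrite -itvE; near: h; exact: withinT.
  have sh : s != s + h by rewrite eq_sym -subr_eq0 addrC addKr.
  have E : (fun x => h^-1 * (u (s + h) x - u s x) - du s x) =
      dquot u s (s + h) \- du s.
    by apply/funext => x; rewrite /dquot /= [s + h - s]addrC addKr.
  have [_ _ jh] := inVB (wV _ _ sD shD) gV.
  rewrite E Vnorm_nrm// !lee_fin nrm_ge0/=.
  by have := Hg _ shD sh; rewrite [s + h - s]addrC addKr.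
- exact: cvg_cst.
- apply: cvg_EFin; first exact: nearW.
  rewrite -[X in _ --> X](mulr0 C); apply: cvgM; first exact: cvg_cst.
  rewrite -[X in _ --> X](@normr0 _ R); apply: cvg_norm.
  by apply: cvg_within_filter; apply: cvg_within_filter; exact: cvg_id.
Unshelve. all: by end_near. Qed.
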